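(* Let $H\in(1/2,1)$, $\gamma\in(1/2,H)$, $\alpha\in\mathbb{R}$, $T>0$, and let $W^H$ be a real-valued fractional Brownian motion with Hurst parameter $H$ on $[0,T]$. Let $Y$ be a process with $$Y\in C\big([0,T],\mathcal{B}_{\alpha-\frac12}\big)\cap C^{\gamma}\big([0,T],\mathcal{B}_{\alpha-\gamma-\frac12}\big),$$ and for $t\in[0,T]$ and $k\ge 0$ set $$I^k_t=\sum_{n\ge 0:\ [\frac{n}{2^k},\frac{n+1}{2^k}]\subset[0,t]}S_{t-\frac{n}{2^k}}Y_{\frac{n}{2^k}}\Big(W^H_{\frac{n+1}{2^k}}-W^H_{\frac{n}{2^k}}\Big).$$ Then, almost surely, for every $t\in[0,T]$ the sequence $(I^k_t)_k$ is Cauchy in $\mathcal{B}_\alpha$. Moreover, defining the integral $$I_t=\int_0^tS_{t-r}Y_r\,dW^H_r:=\lim_{k\to\infty}I^k_t$$ as its limit in $\mathcal{B}_\alpha$, the process $I=(I_t)_{t\in[0,T]}$ belongs to $C([0,T],\mathcal{B}_\alpha)\cap C^{\gamma}([0,T],\mathcal{B}_{\alpha-\gamma})$.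
   Context: For $\alpha\in\mathbb{R}$, $\mathcal{B}_\alpha=H^{2\alpha}(\mathbb{T}^2)$ is the $L^2$-based Sobolev space on the two-dimensional torus, with its norm $\|\cdot\|_\alpha$. $(S_t)_{t\ge0}$ is the analytic (heat) semigroup generated by the Laplace operator $\Delta$ on $\mathbb{T}^2$, acting on all the spaces $\mathcal{B}_\alpha$. $C([0,T],\mathcal{B}_\beta)$ carries the norm $\|y\|_{0,\beta}=\sup_{t\in[0,T]}\|y_t\|_\beta$, and $C^\gamma([0,T],\mathcal{B}_\beta)$ is the space of $\gamma$-Hölder continuous functions with $\|y\|_{\gamma,\beta}=\sup_{s\neq t\in[0,T]}\|y_t-y_s\|_\beta/|t-s|^\gamma<\infty$. All statements are pathwise, for almost every realization (the paths of $W^H$ being almost surely $\gamma'$-Hölder continuous for every $\gamma'<H$). *)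

(* Defs.v *)
From HB Require Import structures.
From mathcomp Require Import all_boot all_order all_algebra.
From mathcomp Require Import complex.
From mathcomp Require Import all_classical all_reals all_analysis.
Set Implicit Arguments.
Unset Strict Implicit.
Unset Printing Implicit Defensive.
Import Order.TTheory GRing.Theory Num.Theory.
Import numFieldNormedType.Exports.
Local Open Scope classical_set_scope.
Local Open Scope complex_scope.
Local Open Scope ring_scope.

(* The torus is T^2 = R^2 / (2 pi Z)^2. A (complex-valued) distribution u on
   T^2 is given by its Fourier coefficients (k1, k2) |-> u^(k), so that all the
   Sobolev spaces H^s(T^2), s of any sign, are subspaces of one ambient space
   and the inclusions H^s(T^2) <= H^r(T^2), r <= s, are literal. *)
Notation torus_distr R := (int * int -> R[i]).

Section sobolev.
Context {R : realType}.

(* |k|^2, the eigenvalue of - Delta on x |-> exp (i k.x). *)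
Definition freq2 (k : int * int) : R := k.1%:~R ^+ 2 + k.2%:~R ^+ 2.

(* ||u||_{H^s} = (\sum_k (1 + |k|^2)^s |u^(k)|^2)^(1/2), equal to +oo exactly
   when u is not in H^s. *)
Definition sobolev_norm (s : R) (u : torus_distr R) : \bar R :=
  ((\esum_(k in [set: int * int])
      ((1 + freq2 k) `^ s * Normc.normc (u k) ^+ 2)%:E) `^ 2^-1)%E.

(* The norm of B_alpha = H^{2 alpha}. *)
Definition Bnorm (alpha : R) : torus_distr R -> \bar R :=
  sobolev_norm (2 * alpha).

Definition B (alpha : R) : set (torus_distr R) :=
  [set u | (Bnorm alpha u < +oo)%E].

(* S_t = exp (t Delta). *)
Definition heat (t : R) (u : torus_distr R) : torus_distr R :=
  fun k => (expR (- t * freq2 k))%:C * u k.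

Definition cauchy_in_B (alpha : R) (u : nat -> torus_distr R) : Prop :=
  (forall n, B alpha (u n)) /\
  (forall e : R, 0 < e -> exists N : nat, forall m n : nat,
     (N <= m)%N -> (N <= n)%N -> (Bnorm alpha (u m - u n)%R < e%:E)%E).

Definition cvg_in_B (alpha : R) (u : nat -> torus_distr R)
    (l : torus_distr R) : Prop :=
  B alpha l /\ (Bnorm alpha (u n - l) @[n --> \oo] --> (0 : \bar R)).

(* Meaningful only when a limit exists; defaults to 0 otherwise. *)
Definition lim_in_B (alpha : R) (u : nat -> torus_distr R) : torus_distr R :=
  xget 0 [set l | cvg_in_B alpha u l].

End sobolev.

(* Path spaces on [0, T], for a space given by a norm N : V -> \bar R which is
   finite exactly on it. The values of paths outside [0, T] are irrelevant. *)
Section path_spaces.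
Context {R : realType} {V : zmodType}.
Implicit Types (N : V -> \bar R) (T gamma : R) (y : R -> V).

Definition continuous_path N T y : Prop :=
  forall t : R, t \in `[0, T] ->
    (N (y t) < +oo)%E /\
    (N (y s - y t) @[s --> within `[0, T]%classic (nbhs t)] --> (0 : \bar R)).

Definition holder_seminorm N T gamma y : \bar R :=
  ereal_sup [set r | exists s t : R, [/\ s \in `[0, T], t \in `[0, T], s != t &
    r = (N (y t - y s)%R * ((`|t - s| `^ gamma)^-1)%:E)%E]].

Definition holder_path N T gamma y : Prop :=
  (forall t : R, t \in `[0, T] -> (N (y t) < +oo)%E) /\
  (holder_seminorm N T gamma y < +oo)%E.

End path_spaces.

Section fractional_brownian_motion.
Context {R : realType} {d : measure_display} {Omega : measurableType d}.
Variable P : probability Omega R.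

(* Degenerate (constant) laws count as Gaussian; they are separated because
   normal_prob m 0 is not a Dirac mass. *)
Definition gaussian (X : Omega -> R) : Prop :=
  (exists m : R, forall A, measurable A -> P (X @^-1` A) = \d_m A) \/
  (exists m s : R, 0 < s /\
     forall A, measurable A -> P (X @^-1` A) = normal_prob m s A).

(* Fractional Brownian motion on [0, T] with Hurst parameter H: the centered
   Gaussian process with the covariance below, in a version whose paths are
   almost surely Hoelder continuous of every order less than H (finite
   dimensional laws alone say nothing about the paths). *)
Record fBm (H T : R) (W : R -> {RV P >-> R}) : Prop := FBm {
  fBm_gaussian : forall (n : nat) (t : 'I_n -> R) (a : 'I_n -> R),
    (forall i, t i \in `[0, T]) ->
    gaussian (fun w => \sum_(i < n) a i * W (t i) w) ;
  fBm_centered : forall t : R, t \in `[0, T] -> ('E_P[W t] = 0)%E ;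
  fBm_covariance : forall s t : R, s \in `[0, T] -> t \in `[0, T] ->
    covariance P (W s) (W t) =
      ((s `^ (2 * H) + t `^ (2 * H) - `|t - s| `^ (2 * H)) / 2)%:E ;
  fBm_holder : forall g : R, 0 < g -> g < H ->
    \forall w \ae P, holder_path (fun x : R => `|x|%:E) T g (fun t => W t w)
}.

End fractional_brownian_motion.

Section stochastic_convolution.
Context {R : realType}.
Implicit Types (Y : R -> torus_distr R) (W : R -> R).

Definition dyadic (k n : nat) : R := n%:R / 2 ^+ k.

Definition convolution_sum Y W (k : nat) (t : R) : torus_distr R :=
  \sum_(n \in [set n : nat | `[dyadic k n, dyadic k n.+1] `<=` `[0, t]])
     (W (dyadic k n.+1) - W (dyadic k n))%:C *:
       heat (t - dyadic k n) (Y (dyadic k n)).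

(* int_0^t S_{t-r} Y_r dW_r, as a limit in B_alpha. *)
Definition convolution_int (alpha : R) Y W (t : R) : torus_distr R :=
  lim_in_B alpha (fun k => convolution_sum Y W k t).

End stochastic_convolution.

(* Main.v *)
Require Import Defs.
From HB Require Import structures.
From mathcomp Require Import all_boot all_order all_algebra.
From mathcomp Require Import finmap complex.
From mathcomp Require Import all_classical all_reals all_analysis.
From mathcomp Require Import lra ring zify.
Set Implicit Arguments.
Unset Strict Implicit.
Unset Printing Implicit Defensive.
Import Order.TTheory GRing.Theory Num.Theory.
Import numFieldNormedType.Exports.
Local Open Scope classical_set_scope.
Local Open Scope complex_scope.
Local Open Scope ring_scope.

(** The statement is pathwise: almost surely the path of W is gamma-Hoelder, and
    for such a path it is a deterministic result on Young integration against
    the heat semigroup, proved by a sewing argument on dyadic partitions.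

    Write D = 2^-k for the mesh, u < m < v for the end points and the midpoint
    of a dyadic interval, W_uv for W_v - W_u and ||.||_a for the norm of B_a.
    Refining the interval changes its contribution to the sum at time t by
      W_mv S_{t-m} ((Y_m - Y_u) - (S_{m-u} - 1) Y_u),
    where the vector inside S_{t-m} has size D^gamma in
    B_{alpha - gamma - 1/2}. Smoothing by S_{t-m} back to B_{alpha + e} costs
    (t-m)^-p with p = 1/2 + gamma + e. For e = (gamma - 1/2) / 2 one has
    p > 1 and 2 gamma = p + e, so that the sum over all the intervals is
    controlled by the p-series: it is at most a constant times D^e,
    uniformly in t ([dyadic_sum_step]). At most two cells are created or
    destroyed at the ends of the range; their size is again D^e, because
    ||S_{t-u} Y_u||_{alpha + e} is of order (t-u)^-(1/2 + e) and t - u >= D. The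
    sums are thus Cauchy in B_{alpha + e}, hence in B_alpha, which is complete
    ([B_complete]).

    For the time regularity, let J_st be the sum over the intervals ending
    in ]s, t]. Then
      I_t - I_s = (S_{t-s} - 1) I_s + J_st.
    Starting the refinement at a mesh comparable to h = t - s gives
    ||J_st||_{alpha + e} <= C h^e and ||J_st||_{alpha - gamma} <= C h^gamma; in
    the second bound the weaker norm leaves a surplus power of t - m, which
    is at most a power of 2 h ([dyadic_sum_conv_bound]). Together with
    ||(S_h - 1) x||_a <= h^r ||x||_{a + r}, applied with r = e and r = gamma,
    this makes I e-Hoelder in B_alpha and gamma-Hoelder in B_{alpha - gamma}.

    All estimates are made on the norms truncated to finitely many frequencies
    ([trunc_norm]), which are finite real seminorms on the space of all
    distributions, with constants that do not depend on the truncation;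
    [Bnorm_le] and [trunc_norm_le] translate them to the Sobolev norms. *)

(** * Sobolev norms truncated to finitely many frequencies *)

Section truncated_norm.
Context {R : realType}.
Implicit Types (b c r t : R) (F : seq (int * int)) (u v : torus_distr R).

(** The symbol 1 + |k|^2 of 1 - Delta. *)
Definition weight (k : int * int) : R := 1 + freq2 k.

(** The norm of B_b restricted to the frequencies listed in [F]; a repeated
    frequency counts as often as it occurs. *)
Definition trunc_norm b F u : R :=
  Num.sqrt (\sum_(k <- F) weight k `^ (2 * b) * Normc.normc (u k) ^+ 2).

Lemma freq2_ge0 k : 0 <= freq2 k :> R.
Proof. by rewrite /freq2 addr_ge0// sqr_ge0. Qed.

Lemma weight_ge1 k : 1 <= weight k.
Proof. by rewrite /weight lerDl freq2_ge0. Qed.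

Lemma weight_gt0 k : 0 < weight k.
Proof. exact: lt_le_trans ltr01 (weight_ge1 k). Qed.

Lemma normc_ge0 (x : R[i]) : 0 <= Normc.normc x.
Proof. by case: x => a b; exact: sqrtr_ge0. Qed.

Lemma normc_real (x : R) : Normc.normc x%:C = `|x|.
Proof. by rewrite /Normc.normc /= expr0n/= addr0 sqrtr_sqr. Qed.

Lemma trunc_norm_term_ge0 b u k :
  0 <= weight k `^ (2 * b) * Normc.normc (u k) ^+ 2.
Proof. by rewrite mulr_ge0 ?powR_ge0// sqr_ge0. Qed.

Lemma trunc_norm_ge0 b F u : 0 <= trunc_norm b F u.
Proof. exact: sqrtr_ge0. Qed.

Lemma trunc_norm_nil b u : trunc_norm b [::] u = 0.
Proof. by rewrite /trunc_norm big_nil sqrtr0. Qed.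

(** Adding one frequency adds one orthogonal coordinate, so the truncated norm
    is the modulus of a complex number; this reduces the triangle inequality
    to that of the modulus. *)
Lemma trunc_norm_cons b k F u : trunc_norm b (k :: F) u =
  Normc.normc (Complex (weight k `^ b * Normc.normc (u k)) (trunc_norm b F u)).
Proof.
rewrite /trunc_norm /Normc.normc big_cons sqr_sqrtr; last first.
  by apply: sumr_ge0 => i _; exact: trunc_norm_term_ge0.
by rewrite exprMn -(powR_mulrn _ (powR_ge0 _ _)) -powRrM [b * _]mulrC.
Qed.

Lemma normc_le_homo (a b c d : R) : 0 <= a -> a <= c -> 0 <= b -> b <= d ->
  Normc.normc (Complex a b) <= Normc.normc (Complex c d).
Proof.
move=> a0 ac b0 bd; rewrite /Normc.normc ler_wsqrtr// lerD//.
  by rewrite ler_sqr ?nnegrE ?(le_trans a0).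
by rewrite ler_sqr ?nnegrE ?(le_trans b0).
Qed.

Lemma normc_scale (c x y : R) : 0 <= c ->
  Normc.normc (Complex (c * x) (c * y)) = c * Normc.normc (Complex x y).
Proof.
move=> c0; rewrite /Normc.normc !exprMn -mulrDr sqrtrM ?sqr_ge0//.
by rewrite sqrtr_sqr ger0_norm.
Qed.

(** Every operator below acts diagonally on Fourier coefficients, so its
    bounds reduce to bounds on multipliers, uniformly in [F]. *)
Lemma trunc_norm_diag b b' c F u v : 0 <= c ->
  (forall k, weight k `^ b * Normc.normc (u k) <=
             c * (weight k `^ b' * Normc.normc (v k))) ->
  trunc_norm b F u <= c * trunc_norm b' F v.
Proof.
move=> c0 uv; elim: F => [|k F IH]; first by rewrite !trunc_norm_nil mulr0.
rewrite !trunc_norm_cons -normc_scale//.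
by apply: normc_le_homo; rewrite ?trunc_norm_ge0// mulr_ge0 ?powR_ge0 ?normc_ge0.
Qed.

Lemma trunc_normD b F u v :
  trunc_norm b F (u + v) <= trunc_norm b F u + trunc_norm b F v.
Proof.
elim: F => [|k F IH]; first by rewrite !trunc_norm_nil addr0.
rewrite !trunc_norm_cons; apply: le_trans (le_normcD _ _).
apply: normc_le_homo; rewrite ?trunc_norm_ge0//.
  by rewrite mulr_ge0 ?powR_ge0 ?normc_ge0.
by rewrite -mulrDr ler_wpM2l ?powR_ge0// le_normcD.
Qed.

Lemma trunc_normZ b F (z : R[i]) u :
  trunc_norm b F (z *: u) <= Normc.normc z * trunc_norm b F u.
Proof.
apply: trunc_norm_diag => [|k]; first exact: normc_ge0.
by rewrite fctE /= Normc.normcM mulrCA.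
Qed.

Lemma trunc_norm0 b F : trunc_norm b F 0 = 0.
Proof.
apply/eqP; rewrite eq_le trunc_norm_ge0 andbT -[leRHS](mul0r (trunc_norm b F 0)).
apply: trunc_norm_diag => // k.
have -> : Normc.normc ((0 : torus_distr R) k) = 0 by exact: Normc.normc0.
by rewrite mulr0 mul0r.
Qed.

Lemma trunc_normN b F u : trunc_norm b F (- u) = trunc_norm b F u.
Proof.
suff le v : trunc_norm b F (- v) <= trunc_norm b F v.
  by apply/eqP; rewrite eq_le le -{1}[u]opprK le.
rewrite -[leRHS]mul1r; apply: trunc_norm_diag => // k.
by rewrite mul1r (_ : Normc.normc ((- v) k) = Normc.normc (v k))//; exact: normcN.
Qed.

Lemma trunc_norm_distC b F u v :
  trunc_norm b F (u - v) = trunc_norm b F (v - u).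
Proof. by rewrite -trunc_normN opprB. Qed.

Lemma trunc_norm_sum b F (m n : nat) (f : nat -> torus_distr R) :
  trunc_norm b F (\sum_(m <= i < n) f i) <= \sum_(m <= i < n) trunc_norm b F (f i).
Proof.
elim/big_rec2 : _ => [|i x y _ xy]; first by rewrite trunc_norm0.
by apply: le_trans (trunc_normD _ _ _ _) _; rewrite lerD2l.
Qed.

Lemma le_trunc_norm b b' F u : b <= b' -> trunc_norm b F u <= trunc_norm b' F u.
Proof.
move=> bb'; rewrite -[leRHS]mul1r; apply: trunc_norm_diag => // k.
by rewrite mul1r ler_wpM2r ?normc_ge0// ler_powR// weight_ge1.
Qed.

Lemma trunc_norm_sumr b F u : trunc_norm b F u <=
  \sum_(k <- F) weight k `^ b * Normc.normc (u k).
Proof.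
elim: F => [|k F IH]; first by rewrite trunc_norm_nil big_nil.
rewrite trunc_norm_cons big_cons.
set x := weight k `^ b * _; set y := trunc_norm b F u.
have x0 : 0 <= x by rewrite mulr_ge0 ?powR_ge0 ?normc_ge0.
have y0 : 0 <= y by exact: trunc_norm_ge0.
apply: (@le_trans _ _ (x + y)); last by rewrite lerD2l.
rewrite -[leRHS]ger0_norm ?addr_ge0// -sqrtr_sqr /Normc.normc ler_wsqrtr//.
by rewrite sqrrD lerD2r lerDl mulrn_wge0// mulr_ge0.
Qed.

Lemma trunc_norm_seq1 b k u :
  trunc_norm b [:: k] u = weight k `^ b * Normc.normc (u k).
Proof.
rewrite trunc_norm_cons trunc_norm_nil [LHS]normc_real ger0_norm//.
by rewrite mulr_ge0 ?powR_ge0 ?normc_ge0.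
Qed.

Lemma trunc_norm_fset1 b k u :
  trunc_norm b [fset k]%fset u = weight k `^ b * Normc.normc (u k).
Proof. by rewrite -trunc_norm_seq1 /trunc_norm big_seq_fset1 big_seq1. Qed.

(** A bound on all the truncated norms is a bound on the Sobolev norm, and
    conversely ([trunc_norm_le]). *)
Lemma Bnorm_le b u (M : R) :
  (forall F : {fset int * int}, trunc_norm b F u <= M) -> (Bnorm b u <= M%:E)%E.
Proof.
move=> uM; have M0 : 0 <= M by exact: le_trans (trunc_norm_ge0 _ _ _) (uM fset0).
rewrite /Bnorm /sobolev_norm -[leRHS](_ : (((M ^+ 2)%:E) `^ 2^-1)%E = _); last first.
  by rewrite poweR_EFin powR12_sqrt ?sqr_ge0// sqrtr_sqr ger0_norm.
have term0 k : (0 <= (weight k `^ (2 * b) * Normc.normc (u k) ^+ 2)%:E)%E.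
  by rewrite lee_fin trunc_norm_term_ge0.
apply: gt0_ler_poweR => //; rewrite ?in_itv/= ?leey ?andbT.
- by apply: esum_ge0 => k _; exact: term0.
- by rewrite lee_fin sqr_ge0.
apply: ge_ereal_sup => _ [A [finA _] <-].
rewrite fsbig_finite//= sumEFin lee_fin.
have s0 : 0 <= \sum_(k <- fset_set A) weight k `^ (2 * b) * Normc.normc (u k) ^+ 2.
  by apply: sumr_ge0 => i _; exact: trunc_norm_term_ge0.
by rewrite -(sqr_sqrtr s0) ler_sqr ?nnegrE ?sqrtr_ge0//; exact: uM.
Qed.

Lemma trunc_norm_le b u (M : R) (F : {fset int * int}) : 0 <= M ->
  (Bnorm b u <= M%:E)%E -> trunc_norm b F u <= M.
Proof.
move=> M0; rewrite /Bnorm /sobolev_norm; set S := (\esum_(k in _) _)%E => SM.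
have S0 : (0 <= S)%E.
  by apply: esum_ge0 => k _; rewrite lee_fin trunc_norm_term_ge0.
have FS : ((\sum_(k <- F) weight k `^ (2 * b) * Normc.normc (u k) ^+ 2)%:E <= S)%E.
  apply: esum_ge; exists [set` F]; first by split => //; exact: finite_fset.
  by rewrite fsbig_finite ?finite_fset//= set_fsetK sumEFin.
rewrite -lee_fin; apply: le_trans SM.
have s0 : 0 <= \sum_(k <- F) weight k `^ (2 * b) * Normc.normc (u k) ^+ 2.
  by apply: sumr_ge0 => i _; exact: trunc_norm_term_ge0.
rewrite /trunc_norm -powR12_sqrt// -poweR_EFin.
by apply: gt0_ler_poweR; rewrite ?in_itv/= ?leey ?andbT.
Qed.

Lemma Bnorm_ge0 b u : (0 <= Bnorm b u)%E.
Proof. exact: poweR_ge0. Qed.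

End truncated_norm.

(** * Smoothing and time regularity of the heat semigroup *)

Section heat_semigroup.
Context {R : realType}.
Implicit Types (b c r s t : R) (F : seq (int * int)) (u v : torus_distr R).

Lemma heatE t u k : heat t u k = (expR (- t * freq2 k))%:C * u k.
Proof. by []. Qed.

Lemma heat_semigroup s t u : heat (s + t) u = heat s (heat t u).
Proof.
apply/funext => k; rewrite !heatE mulrA -rmorphM/= -expRD.
by rewrite opprD mulrDl.
Qed.

Lemma heatD t u v : heat t (u + v) = heat t u + heat t v.
Proof. by apply/funext => k; rewrite /heat /GRing.add/= mulrDr. Qed.

Lemma heatN t u : heat t (- u) = - heat t u.
Proof. by apply/funext => k; rewrite /heat /GRing.opp/= mulrN. Qed.

Lemma heatB t u v : heat t (u - v) = heat t u - heat t v.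
Proof. by rewrite heatD heatN. Qed.

Lemma heat0 t : heat t 0 = 0 :> torus_distr R.
Proof. by apply: (addrI (heat t 0)); rewrite -heatD !addr0. Qed.

Lemma heatZ t (z : R[i]) u : heat t (z *: u) = z *: heat t u.
Proof. by apply/funext => k; rewrite /heat !fctE mulrCA. Qed.

Lemma heat_sum t (m n : nat) (f : nat -> torus_distr R) :
  heat t (\sum_(m <= i < n) f i) = \sum_(m <= i < n) heat t (f i).
Proof. by apply: (big_morph (heat t) (heatD t) (heat0 t)). Qed.

(** The r-th power of x / r <= exp (x / r). *)
Lemma powR_le_expR r x : 0 <= r -> 0 <= x -> x `^ r <= r `^ r * expR x.
Proof.
rewrite le_eqVlt => /predU1P[<- x0|r0 x0].
  by rewrite !powRr0 mul1r -[leLHS]expR0 ler_expR.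
have xE : x = r * (x / r) by rewrite mulrCA divff ?gt_eqF// mulr1.
rewrite {1}xE powRM ?(ltW r0) ?divr_ge0 ?(ltW r0)//.
rewrite ler_wpM2l ?powR_ge0//.
rewrite [expR x](_ : _ = (expR (x / r)) `^ r); last first.
  by rewrite /powR expR_eq0 expRK -xE.
apply: ge0_ler_powR; rewrite ?nnegrE ?expR_ge0 ?divr_ge0 ?(ltW r0)//.
by apply: le_trans (expR_ge1Dx _); rewrite lerDr.
Qed.

Lemma trunc_norm_heat_diag b b' c t F u : 0 <= c ->
  (forall k, weight k `^ b * expR (- t * freq2 k) <= c * weight k `^ b') ->
  trunc_norm b F (heat t u) <= c * trunc_norm b' F u.
Proof.
move=> c0 h; apply: trunc_norm_diag => // k.
rewrite heatE Normc.normcM normc_real ger0_norm ?expR_ge0// !mulrA.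
by rewrite ler_wpM2r ?normc_ge0.
Qed.

Lemma heat_contraction b t F u : 0 <= t ->
  trunc_norm b F (heat t u) <= trunc_norm b F u.
Proof.
move=> t0; rewrite -[leRHS]mul1r; apply: trunc_norm_heat_diag => // k.
rewrite mul1r ler_piMr ?powR_ge0// expR_le1 mulNr oppr_le0.
by rewrite mulr_ge0 ?freq2_ge0.
Qed.

(** The factor [expR T] accounts for the Laplace operator having the eigenvalue
    0 while the weights are 1 + |k|^2. *)
Lemma heat_smoothing b r t T F u : 0 <= r -> 0 < t -> t <= T ->
  trunc_norm (b + r) F (heat t u) <=
  expR T * r `^ r * t `^ (- r) * trunc_norm b F u.
Proof.
move=> r0 t0 tT; have t0' := ltW t0.
apply: trunc_norm_heat_diag => [|k].
  by rewrite !mulr_ge0 ?expR_ge0 ?powR_ge0.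
have w0 := @weight_gt0 R k.
rewrite powRD; last by rewrite (gt_eqF w0) implybT.
rewrite mulrC mulrCA mulrA [leRHS]mulrC -mulrA ler_wpM2l ?powR_ge0//.
rewrite powRN ler_pdivlMr ?powR_gt0// -mulrA -powRM ?(ltW w0)//.
have := powR_le_expR r0 (mulr_ge0 (ltW w0) t0').
move=> /(ler_wpM2l (expR_ge0 (- t * freq2 k))) /le_trans -> //.
rewrite mulrCA [leRHS]mulrC ler_wpM2l ?powR_ge0// -expRD ler_expR /weight.
by lra.
Qed.

(** On each frequency 1 - exp (- x) <= min (1, x) <= x^r for r in [0, 1]. *)
Lemma trunc_norm_heat_sub b r t F u : 0 <= r -> r <= 1 -> 0 <= t ->
  trunc_norm b F (heat t u - u) <= t `^ r * trunc_norm (b + r) F u.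
Proof.
move=> r0 r1 t0; apply: trunc_norm_diag => [|k]; first exact: powR_ge0.
have w0 := @weight_gt0 R k.
have -> : (heat t u - u) k = (expR (- t * freq2 k) - 1)%:C * u k.
  by rewrite rmorphB rmorph1 mulrBl mul1r.
rewrite Normc.normcM normc_real powRD; last by rewrite (gt_eqF w0) implybT.
rewrite [leRHS]mulrCA -!mulrA ler_wpM2l ?powR_ge0// mulrA.
rewrite ler_wpM2r ?normc_ge0// -powRM ?(ltW w0)//.
rewrite ?[weight k * t]mulrC.
have tf0 : 0 <= t * freq2 k :> R by rewrite mulr_ge0 ?freq2_ge0.
rewrite distrC ger0_norm; last by rewrite subr_ge0 expR_le1 mulNr oppr_le0.
have tw : t * freq2 k <= t * weight k by rewrite ler_wpM2l// /weight lerDr.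
have e1 := expR_ge1Dx (- t * freq2 k).
have e0 := expR_ge0 (- t * freq2 k).
have [tw1|tw1] := leP 1 (t * weight k).
  apply: (@le_trans _ _ 1); first by lra.
  rewrite -[leLHS](_ : 1 `^ r = 1); last by rewrite powR1.
  by apply: ge0_ler_powR => //; rewrite nnegrE ?mulr_ge0// ltW.
apply: (@le_trans _ _ (t * weight k)); first by lra.
move: t0; rewrite le_eqVlt => /predU1P[<-|t0].
  by rewrite mul0r powR_ge0.
by apply: ger1_powR => //; rewrite mulr_gt0// ltW.
Qed.

End heat_semigroup.

(** * Dyadic grids and a p-series bound *)

Section dyadic_sums.
Context {R : realType}.
Implicit Types (e p s t : R) (k m n : nat).

Lemma powR2N_lt1 e : 0 < e -> 2 `^ (- e) < 1 :> R.
Proof.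
move=> e0; rewrite powRN invf_lt1 ?powR_gt0// -[X in X < _](powRr0 2).
by rewrite /powR pnatr_eq0/= ltr_expR ltr_pM2r// ln_gt0// ltr1n.
Qed.

(** Let [S n] be the sum on the left. Grouping the terms of the sum of length
    [n.*2.+1] by pairs after the first one gives
    [S n.*2.+1 <= 1 + 2 `^ (1 - p) * S n], while [S n <= S n.*2.+1]. *)
Lemma psum_bound p n : 1 < p ->
  \sum_(0 <= j < n) (j.+1%:R : R) `^ (- p) <= (1 - 2 `^ (1 - p))^-1.
Proof.
move=> p1; pose S n : R := \sum_(0 <= j < n) j.+1%:R `^ (- p).
have S_mono m l : (m <= l)%N -> S m <= S l.
  move=> ml; rewrite /S [leRHS](big_cat_nat (n := m))//= lerDl.
  by apply: sumr_ge0 => i _; exact: powR_ge0.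
have S_double m : S m.*2.+1 <= 1 + 2 `^ (1 - p) * S m.
  elim: m => [|m IH].
    by rewrite /S big_nat1 big_geq// mulr0 addr0 powR1.
  rewrite /S doubleS [in leLHS]big_nat_recr//= [in leLHS]big_nat_recr//= [in leRHS]big_nat_recr//=.
  have e : 2 `^ (1 - p) * m.+1%:R `^ (- p) = m.*2.+2%:R `^ (- p) *+ 2.
    rewrite powRD; last by rewrite pnatr_eq0 implybT.
    rewrite powRr1// -mulrA -powRM// -natrM mulr_natl.
    by congr (_%:R `^ _ *+ 2); lia.
  have l : m.*2.+3%:R `^ (- p) <= m.*2.+2%:R `^ (- p) :> R.
    rewrite !powRN lef_pV2 ?posrE ?powR_gt0//.
    by apply: ge0_ler_powR; rewrite ?nnegrE// ?ler_nat//; lra.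
  by move: IH; rewrite mulrDr e mulr2n /S; lra.
have c1 : 2 `^ (1 - p) < 1 :> R by rewrite -opprB powR2N_lt1// subr_gt0.
rewrite -[leRHS]mul1r ler_pdivlMr ?subr_gt0// -/(S n).
have := le_trans (S_mono n n.*2.+1 _) (S_double n).
by rewrite -addnn => /(_ ltac:(lia)); lra.
Qed.

(** The number of dyadic intervals of level [k] contained in [[0, t]]. *)
Definition ncells k t : nat := Num.truncn (t * 2 ^+ k).

Lemma exp2_gt0 k : 0 < 2 ^+ k :> R.
Proof. by rewrite exprn_gt0. Qed.

Lemma ncellsP k t n : (n < ncells k t)%N = (dyadic k n.+1 <= t).
Proof. by rewrite truncn_gt_nat /dyadic ler_pdivrMr ?exp2_gt0. Qed.

Lemma ncells_le k s t : s <= t -> (ncells k s <= ncells k t)%N.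
Proof. by move=> st; apply: le_truncn; rewrite ler_wpM2r// ltW ?exp2_gt0. Qed.

Lemma ncells0 k : ncells k 0 = 0%N.
Proof. by rewrite /ncells mul0r truncn0. Qed.

Lemma ncells_gt k s n : (ncells k s <= n)%N -> s < dyadic k n.+1.
Proof. by move=> h; rewrite ltNge -ncellsP -leqNgt. Qed.

Lemma dyadic_double k n : dyadic k.+1 n.*2 = dyadic k n :> R.
Proof.
by rewrite /dyadic exprS -muln2 natrM [n%:R * _]mulrC -mulf_div divff ?mul1r// pnatr_eq0.
Qed.

Lemma dyadic_mono k m n : (m <= n)%N -> dyadic k m <= dyadic k n :> R.
Proof. by move=> mn; rewrite ler_pM2r ?invr_gt0 ?exp2_gt0// ler_nat. Qed.

Lemma dyadic_ge0 k n : 0 <= dyadic k n :> R.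
Proof. by rewrite divr_ge0// ltW ?exp2_gt0. Qed.

Lemma dyadicB k n : dyadic k n.+1 - dyadic k n = (2 ^+ k)^-1 :> R.
Proof. by rewrite /dyadic -mulrBl -natrB// subSnn mul1r. Qed.

(** Halving the mesh doubles the number of complete cells in [[0, t]], or adds
    one more to that. *)
Lemma ncells_half k t : 0 <= t -> (ncells k.+1 t)./2 = ncells k t.
Proof.
move=> t0; apply/esym/truncn_def.
have := @truncn_itv _ (t * 2 ^+ k.+1) _.
rewrite mulr_ge0 ?(ltW (exp2_gt0 _))// => /(_ isT).
rewrite -/(ncells k.+1 t) exprS mulrCA.
have e : (ncells k.+1 t)%:R =
    (odd (ncells k.+1 t))%:R + 2 * (ncells k.+1 t)./2%:R :> R.
  by rewrite -{1}(odd_double_half (ncells k.+1 t)) natrD -muln2 natrM [2 * _]mulrC.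
rewrite -[(ncells k.+1 t).+1%:R]natr1 -[(_./2).+1%:R]natr1 e.
have o0 : 0 <= (odd (ncells k.+1 t))%:R :> R by [].
have o1 : (odd (ncells k.+1 t))%:R <= 1 :> R by case: odd.
by lra.
Qed.

(** The reciprocal powers of the distances from [t] to the midpoints of the
    dyadic intervals in [[0, t]] sum up like a [p]-series. *)
Lemma sum_dist_midpoint p k m t : 1 < p -> 0 <= t ->
  \sum_(m <= n < ncells k t) (t - dyadic k.+1 n.*2.+1) `^ (- p) <=
  2 `^ p * (1 - 2 `^ (1 - p))^-1 * (2 ^+ k) `^ p.
Proof.
move=> p1 t0; set N := ncells k t; have p0 : 0 <= p by lra.
have Nt : N%:R / 2 ^+ k <= t.
  by rewrite ler_pdivrMr ?exp2_gt0// truncn_le mulr_ge0// ltW ?exp2_gt0.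
apply: (@le_trans _ _
    (\sum_(0 <= n < N) 2 `^ p * (2 ^+ k) `^ p * (N - n)%:R `^ (- p))); last first.
  rewrite -mulr_sumr [leRHS]mulrAC ler_wpM2l ?mulr_ge0 ?powR_ge0//.
  rewrite big_nat_rev/= add0n.
  apply: le_trans (psum_bound N p1); rewrite le_eqVlt; apply/orP; left; apply/eqP.
  by apply: eq_big_nat => i iN; congr (_%:R `^ _); lia.
have [Nm|mN] := leqP N m.
  by rewrite big_geq//; apply: sumr_ge0 => i _; rewrite !mulr_ge0 ?powR_ge0.
rewrite [leRHS](big_cat_nat (n := m))//=; last exact: ltnW.
rewrite ler_wpDl//; first by apply: sumr_ge0 => i _; rewrite !mulr_ge0 ?powR_ge0.
rewrite !big_nat; apply: ler_sum => n /andP[_ nN].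
have Nn0 : 0 < (N - n)%:R :> R by rewrite ltr0n subn_gt0.
(* The midpoint is N - n - 1/2 meshes from the last grid point before [t]. *)
have key : (N - n)%:R / 2 / 2 ^+ k <= t - dyadic k.+1 n.*2.+1.
  apply: le_trans (lerB Nt (lexx _)).
  rewrite /dyadic exprS invfM [n.*2.+1%:R * _]mulrA -mulrBl ler_pM2r ?invr_gt0 ?exp2_gt0//.
  have -> : n.*2.+1%:R = 2 * n%:R + 1 :> R by rewrite -natr1 -muln2 natrM mulrC.
  have : 1 <= (N - n)%:R :> R by rewrite ler1n subn_gt0.
  by rewrite natrB ?(ltnW nN)//; lra.
have pos : 0 < (N - n)%:R / 2 / 2 ^+ k :> R by rewrite !divr_gt0// exp2_gt0.
apply: (@le_trans _ _ (((N - n)%:R / 2 / 2 ^+ k) `^ (- p))).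
  rewrite !powRN lef_pV2 ?posrE ?powR_gt0//; last exact: lt_le_trans key.
  apply: ge0_ler_powR; rewrite ?nnegrE ?(ltW pos)//.
  exact: le_trans (ltW pos) key.
rewrite !powRM ?invr_ge0 ?divr_ge0 ?(ltW (exp2_gt0 _))//.
rewrite -[2^-1]powR_inv1// -[(2 ^+ k)^-1]powR_inv1 ?(ltW (exp2_gt0 _))//.
by rewrite -!powRrM mulrNN !mul1r [leRHS]mulrC mulrA.
Qed.

End dyadic_sums.

(** * The sewing estimate for dyadic sums *)

Section dyadic_refinement.
Context {R : realType}.
Implicit Types (b p e s t A D : R) (F : seq (int * int)) (k m n : nat).

Lemma big_nat_double (V : zmodType) (f : nat -> V) n :
  \sum_(0 <= i < n.*2) f i = \sum_(0 <= i < n) (f i.*2 + f i.*2.+1).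
Proof.
elim: n => [|n IH]; first by rewrite !big_geq.
by rewrite doubleS !big_nat_recr//= IH addrA.
Qed.

Lemma big_nat_sub (V : zmodType) (f : nat -> V) m n : (m <= n)%N ->
  \sum_(m <= i < n) f i = \sum_(0 <= i < n) f i - \sum_(0 <= i < m) f i.
Proof.
by move=> mn; rewrite [X in X - _](big_cat_nat (n := m))//= addrAC subrr add0r.
Qed.

(** A sum of [f] over the cells of a grid and a sum of [g] over those of the
    grid twice as coarse: each coarse cell is compared with its two halves, and
    at each end of the range one unpaired fine cell may remain. *)
Lemma big_nat_refine (V : zmodType) (f g : nat -> V) m n : (m <= n)%N ->
  (m./2 <= n./2)%N ->
  \sum_(m <= i < n) f i - \sum_(m./2 <= i < n./2) g i =
  \sum_(m./2 <= i < n./2) (f i.*2 + f i.*2.+1 - g i) +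
  ((if odd n then f n./2.*2 else 0) - (if odd m then f m./2.*2 else 0)).
Proof.
move=> mn mn2.
have S l : \sum_(0 <= i < l) f i = \sum_(0 <= i < l./2) (f i.*2 + f i.*2.+1) +
    (if odd l then f l./2.*2 else 0).
  rewrite -{1}(odd_double_half l); case: (odd l) => /=.
    by rewrite add1n big_nat_recr//= big_nat_double.
  by rewrite add0n big_nat_double addr0.
rewrite sumrB (big_nat_sub f mn) !S.
rewrite (big_nat_sub (fun i => f i.*2 + f i.*2.+1) mn2).
by rewrite opprD [X in X - _ = _]addrACA [LHS]addrAC.
Qed.

(** The sum of [f k n] over the dyadic cells n of level k whose right end point
    lies in ]s, t]; for [s = 0] these are all the cells contained in [[0, t]]. *)
Definition dyadic_sum (f : nat -> nat -> torus_distr R) k s t : torus_distr R :=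
  \sum_(ncells k s <= n < ncells k t) f k n.

Lemma powR_exp2 k e : (2 ^+ k : R) `^ (- e) = (2 `^ (- e)) ^+ k.
Proof. by rewrite -powR_mulrn// -powRrM mulrC powRrM powR_mulrn// powR_ge0. Qed.

Lemma psum_const_ge0 p : 1 < p -> 0 <= (1 - 2 `^ (1 - p))^-1 :> R.
Proof.
by move=> p1; rewrite invr_ge0 subr_ge0 -opprB ltW// powR2N_lt1// subr_gt0.
Qed.

(** The constant of the sewing estimate: [A] bounds the defects of additivity,
    [D] the single terms. *)
Definition sewing_const p e A D : R :=
  (A * (2 `^ p * (1 - 2 `^ (1 - p))^-1) + 2 * D) / (1 - 2 `^ (- e)).

Lemma sewing_const_ge0 p e A D : 1 < p -> 0 < e -> 0 <= A -> 0 <= D ->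
  0 <= sewing_const p e A D.
Proof.
move=> p1 e0 A0 D0; apply: divr_ge0; last by rewrite subr_ge0 ltW ?powR2N_lt1.
apply: addr_ge0; apply: mulr_ge0 => //.
by rewrite mulr_ge0 ?powR_ge0 ?psum_const_ge0.
Qed.

(** One refinement step. The defect of additivity of a cell with midpoint m is
    bounded by mesh^(p + e) (t - m)^-p, which sums up to mesh^e. *)
Lemma dyadic_sum_step b F (f : nat -> nat -> torus_distr R) p e s t k A D :
  0 <= s -> s <= t -> 1 < p -> 0 < e -> 0 <= A -> 0 <= D ->
  (forall n, (ncells k s <= n)%N -> (n < ncells k t)%N ->
    trunc_norm b F (f k.+1 n.*2 + f k.+1 n.*2.+1 - f k n) <=
    A * (2 ^+ k) `^ (- (p + e)) * (t - dyadic k.+1 n.*2.+1) `^ (- p)) ->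
  (forall n, (n < ncells k.+1 t)%N ->
    trunc_norm b F (f k.+1 n) <= D * (2 `^ (- e)) ^+ k) ->
  trunc_norm b F (dyadic_sum f k.+1 s t - dyadic_sum f k s t) <=
  (A * (2 `^ p * (1 - 2 `^ (1 - p))^-1) + 2 * D) * (2 `^ (- e)) ^+ k.
Proof.
move=> s0 st p1 e0 A0 D0 hA hD.
have t0 : 0 <= t by exact: le_trans st.
rewrite /dyadic_sum -!(@ncells_half _ k)//.
have Nst := ncells_le k.+1 st.
rewrite big_nat_refine//; last exact: half_leq.
apply: le_trans (trunc_normD _ _ _ _) _; rewrite mulrDl lerD//.
  rewrite !ncells_half//.
  apply: le_trans (trunc_norm_sum _ _ _ _ _) _.
  apply: (@le_trans _ _ (\sum_(ncells k s <= n < ncells k t)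
      A * (2 ^+ k) `^ (- (p + e)) * (t - dyadic k.+1 n.*2.+1) `^ (- p))).
    by rewrite !big_nat; apply: ler_sum => n /andP[? ?]; exact: hA.
  rewrite -mulr_sumr.
  apply: le_trans (ler_wpM2l _ (sum_dist_midpoint _ _ p1 t0)) _.
    by rewrite mulr_ge0 ?powR_ge0.
  rewrite -!mulrA ler_wpM2l// mulrCA ler_wpM2l ?powR_ge0// mulrCA.
  rewrite ler_wpM2l ?psum_const_ge0//.
  rewrite -powRD; last first.
    by apply/implyP => _; rewrite gt_eqF ?exp2_gt0.
  by rewrite -powR_exp2 opprD addrAC addNr add0r.
rewrite mulr2n mulrDl mul1r mulrDl; apply: le_trans (trunc_normD _ _ _ _) _.
rewrite trunc_normN.
have bd n : (n <= ncells k.+1 t)%N ->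
    trunc_norm b F (if odd n then f k.+1 n./2.*2 else 0) <= D * (2 `^ (- e)) ^+ k.
  case: ifPn => [no nt|_ _].
    by apply: hD; rewrite -(odd_double_half n) no add1n in nt.
  by rewrite trunc_norm0 mulr_ge0// exprn_ge0// powR_ge0.
by rewrite lerD// bd.
Qed.

(** The geometric bound on the increments is propagated in the form
    D / (1 - rho) * (rho^k - rho^m), which is stable under adding an increment. *)
Lemma geometric_telescope b F (x : nat -> torus_distr R) (rho D : R) k0 :
  0 <= rho -> rho < 1 -> 0 <= D ->
  (forall k, (k0 <= k)%N -> trunc_norm b F (x k.+1 - x k) <= D * rho ^+ k) ->
  forall k m, (k0 <= k)%N -> (k <= m)%N ->
  trunc_norm b F (x m - x k) <= D / (1 - rho) * rho ^+ k.
Proof.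
move=> r0 r1 D0 h k m k0k km.
suff : trunc_norm b F (x m - x k) <= D / (1 - rho) * (rho ^+ k - rho ^+ m).
  move/le_trans; apply; rewrite ler_wpM2l ?divr_ge0 ?subr_ge0 ?(ltW r1)//.
  by rewrite gerBl exprn_ge0.
elim: m km => [|m IH].
  by rewrite leqn0 => /eqP ->; rewrite !subrr trunc_norm0 mulr0.
rewrite leq_eqVlt => /predU1P[->|km]; first by rewrite !subrr trunc_norm0 mulr0.
have -> : x m.+1 - x k = (x m.+1 - x m) + (x m - x k) by rewrite addrA subrK.
apply: le_trans (trunc_normD _ _ _ _) _.
apply: le_trans (lerD (h m (leq_trans k0k km)) (IH km)) _.
rewrite le_eqVlt; apply/orP; left; apply/eqP.
have r1' : 1 - rho != 0 by rewrite subr_eq0 gt_eqF.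
by rewrite exprS; field.
Qed.

(** The initial sum at level [k0] has at most [L + 1] terms; all later ones
    differ from it by a geometric series. *)
Lemma dyadic_sum_bound b F (f : nat -> nat -> torus_distr R) p e s t k0 A D L :
  0 <= s -> s <= t -> 1 < p -> 0 < e -> 0 <= A -> 0 <= D ->
  (t - s) * 2 ^+ k0 <= L ->
  (forall k n, (k0 <= k)%N -> (ncells k s <= n)%N -> (n < ncells k t)%N ->
    trunc_norm b F (f k.+1 n.*2 + f k.+1 n.*2.+1 - f k n) <=
    A * (2 ^+ k) `^ (- (p + e)) * (t - dyadic k.+1 n.*2.+1) `^ (- p)) ->
  (forall k n, (k0 <= k)%N -> (n < ncells k t)%N ->
    trunc_norm b F (f k n) <= D * (2 `^ (- e)) ^+ k) ->
  (forall k m, (k0 <= k)%N -> (k <= m)%N ->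
    trunc_norm b F (dyadic_sum f m s t - dyadic_sum f k s t) <=
    sewing_const p e A D * (2 `^ (- e)) ^+ k) /\
  (forall k, (k0 <= k)%N ->
    trunc_norm b F (dyadic_sum f k s t) <=
    ((L + 1) * D + sewing_const p e A D) * (2 `^ (- e)) ^+ k0).
Proof.
move=> s0 st p1 e0 A0 D0 hL hA hD.
have t0 : 0 <= t by exact: le_trans st.
have r0 : 0 <= 2 `^ (- e) :> R by exact: powR_ge0.
have r1 : 2 `^ (- e) < 1 :> R by exact: powR2N_lt1.
have cp0 := psum_const_ge0 p1.
have step k : (k0 <= k)%N ->
    trunc_norm b F (dyadic_sum f k.+1 s t - dyadic_sum f k s t) <=
    (A * (2 `^ p * (1 - 2 `^ (1 - p))^-1) + 2 * D) * (2 `^ (- e)) ^+ k.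
  move=> kk; apply: dyadic_sum_step => // n; first by move=> ? ?; exact: hA.
  move=> nt; apply: le_trans (hD _ _ (leqW kk) nt) _.
  by rewrite ler_wpM2l// exprS ler_piMl ?exprn_ge0// ltW.
have cau := geometric_telescope r0 r1 _ step.
have {}cau := cau ltac:(by rewrite addr_ge0 ?mulr_ge0 ?powR_ge0).
split=> // k kk.
rewrite -(subrK (dyadic_sum f k0 s t) (dyadic_sum f k s t)).
apply: le_trans (trunc_normD _ _ _ _) _.
rewrite [leRHS]mulrDl [leRHS]addrC lerD//; first exact: cau.
apply: le_trans (trunc_norm_sum _ _ _ _ _) _.
apply: (@le_trans _ _
    (\sum_(ncells k0 s <= n < ncells k0 t) D * (2 `^ (- e)) ^+ k0)).
  by rewrite !big_nat; apply: ler_sum => n /andP[? ?]; exact: hD.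
rewrite sumr_const_nat -[leLHS]mulr_natl -mulrA ler_wpM2r ?mulr_ge0 ?exprn_ge0//.
rewrite natrB ?ncells_le//.
have h1 : (ncells k0 t)%:R <= t * 2 ^+ k0.
  by rewrite truncn_le mulr_ge0// ltW// exp2_gt0.
have h2 : s * 2 ^+ k0 < (ncells k0 s).+1%:R by exact: truncnS_gt.
by move: h2; rewrite -natr1; lra.
Qed.

End dyadic_refinement.

(** * Estimates on the terms of the convolution sums *)

Section pathwise_estimates.
Context {R : realType}.
Implicit Types (alpha gamma T M e r s t : R) (F : {fset int * int}).
Implicit Types (W : R -> R) (Y : R -> torus_distr R) (k m n : nat).

(** The quantitative regularity of the two paths, with one constant [M] for all
    the norms. The bounds on [Y] are stated on the truncated norms. *)
Record path_bounds alpha gamma T M W Y : Prop := PathBounds {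
  path_bounds_ge0 : 0 <= M ;
  path_bounds_W : forall s t, 0 <= s -> s <= T -> 0 <= t -> t <= T ->
    `|W t - W s| <= M * `|t - s| `^ gamma ;
  path_bounds_Y : forall F t, 0 <= t -> t <= T ->
    trunc_norm (alpha - 2^-1) F (Y t) <= M ;
  path_bounds_dY : forall F s t, 0 <= s -> s <= T -> 0 <= t -> t <= T ->
    trunc_norm (alpha - gamma - 2^-1) F (Y t - Y s) <= M * `|t - s| `^ gamma }.

(** The contribution of the [n]-th cell of level [k] to the sum at time [t]. *)
Definition conv_term W Y t k n : torus_distr R :=
  (W (dyadic k n.+1) - W (dyadic k n))%:C *:
    heat (t - dyadic k n) (Y (dyadic k n)).

(** A cell contained in [[0, t]] starts at distance at least one mesh from [t]. *)
Lemma cell_bounds k n t : (n < ncells k t)%N ->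
  [/\ 0 <= dyadic k n :> R, dyadic k n <= dyadic k n.+1 :> R,
      dyadic k n.+1 <= t & (2 ^+ k)^-1 <= t - dyadic k n].
Proof.
rewrite ncellsP => nt; split => //; first exact: dyadic_ge0.
  exact: dyadic_mono.
by rewrite -(dyadicB k n) lerB.
Qed.

Lemma pow_step k e : (2 ^+ k)^-1 `^ e = (2 ^+ k) `^ (- e) :> R.
Proof. by rewrite -powR_inv1 ?(ltW (exp2_gt0 _))// -powRrM mulN1r. Qed.

Lemma conv_term_incr alpha gamma T M W Y : path_bounds alpha gamma T M W Y ->
  forall t k n, t <= T -> (n < ncells k t)%N ->
  `|W (dyadic k n.+1) - W (dyadic k n)| <= M * (2 ^+ k) `^ (- gamma).
Proof.
move=> PB t k n tT /cell_bounds[u0 uv vt _].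
apply: le_trans (path_bounds_W PB _ _ _ _) _ => //; try lra.
by rewrite dyadicB ger0_norm ?invr_ge0 ?(ltW (exp2_gt0 _))// pow_step.
Qed.

(** Smoothing of order [r] of a single term: the singularity (t - u)^-r is at
    most mesh^-r. *)
Lemma trunc_norm_conv_term alpha gamma T M W Y :
  path_bounds alpha gamma T M W Y ->
  forall r F t k n, 0 <= r -> t <= T -> (n < ncells k t)%N ->
  trunc_norm (alpha - 2^-1 + r) F (conv_term W Y t k n) <=
  M ^+ 2 * (expR T * r `^ r) * (2 ^+ k) `^ (- (gamma - r)).
Proof.
move=> PB r F t k n r0 tT nt; have M0 := path_bounds_ge0 PB.
have [u0 uv vt tu] := cell_bounds nt.
have e0 := @exp2_gt0 R k.
have d0 : 0 < t - dyadic k n by apply: lt_le_trans tu; rewrite invr_gt0.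
apply: le_trans (trunc_normZ _ _ _ _) _; rewrite normc_real.
have dT : t - dyadic k n <= T by lra.
apply: le_trans (ler_pM _ (trunc_norm_ge0 _ _ _) (conv_term_incr PB tT nt)
  (heat_smoothing _ F _ r0 d0 dT)) _ => //.
have qY : trunc_norm (alpha - 2^-1) F (Y (dyadic k n)) <= M.
  by apply: (path_bounds_Y PB); lra.
have dr : (t - dyadic k n) `^ (- r) <= (2 ^+ k) `^ r.
  rewrite -[X in _ <= _ `^ X]opprK -pow_step !powRN.
  rewrite lef_pV2 ?posrE ?powR_gt0 ?invr_gt0//.
  by apply: ge0_ler_powR; rewrite ?nnegrE ?invr_ge0 ?(ltW e0)// ltW.
apply: (@le_trans _ _ (M * (2 ^+ k) `^ (- gamma) *
    (expR T * r `^ r * (2 ^+ k) `^ r * M))).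
  rewrite ler_wpM2l ?mulr_ge0 ?powR_ge0//.
  apply: ler_pM => //; rewrite ?mulr_ge0 ?expR_ge0 ?powR_ge0 ?trunc_norm_ge0//.
  by rewrite ler_wpM2l ?mulr_ge0 ?expR_ge0 ?powR_ge0.
rewrite opprB addrC powRD; last by apply/implyP => _; rewrite gt_eqF.
by rewrite le_eqVlt; apply/orP; left; apply/eqP; ring.
Qed.

(** In B_(alpha - gamma) no smoothing is needed, since [gamma >= 1/2]. *)
Lemma trunc_norm_conv_term_weak alpha gamma T M W Y :
  path_bounds alpha gamma T M W Y ->
  forall F t k n, 2^-1 <= gamma -> t <= T -> (n < ncells k t)%N ->
  trunc_norm (alpha - gamma) F (conv_term W Y t k n) <=
  M ^+ 2 * (2 ^+ k) `^ (- gamma).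
Proof.
move=> PB F t k n g2 tT nt; have M0 := path_bounds_ge0 PB.
have [u0 uv vt tu] := cell_bounds nt.
apply: le_trans (trunc_normZ _ _ _ _) _; rewrite normc_real.
have qY : trunc_norm (alpha - gamma) F
    (heat (t - dyadic k n) (Y (dyadic k n))) <= M.
  apply: le_trans (heat_contraction _ _ _ _) _; first by lra.
  apply: le_trans (le_trunc_norm _ _ (_ : _ <= alpha - 2^-1)) _; first by lra.
  by apply: (path_bounds_Y PB); lra.
apply: le_trans (ler_pM _ (trunc_norm_ge0 _ _ _) (conv_term_incr PB tT nt) qY) _.
  by [].
by rewrite le_eqVlt; apply/orP; left; apply/eqP; ring.
Qed.

(** The defect of additivity of a cell, in which the increment of [W] over its
    left half cancels and the semigroup up to the midpoint is factored out. *)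
Lemma conv_term_refine W Y t k n :
  conv_term W Y t k.+1 n.*2 + conv_term W Y t k.+1 n.*2.+1 - conv_term W Y t k n =
  (W (dyadic k n.+1) - W (dyadic k.+1 n.*2.+1))%:C *:
    heat (t - dyadic k.+1 n.*2.+1)
      (Y (dyadic k.+1 n.*2.+1) - Y (dyadic k n) -
       (heat (dyadic k.+1 n.*2.+1 - dyadic k n) (Y (dyadic k n)) -
        Y (dyadic k n))).
Proof.
rewrite /conv_term -doubleS !dyadic_double.
set u := dyadic k n; set v := dyadic k n.+1; set m := dyadic k.+1 n.*2.+1.
rewrite opprB addrA subrK heatB -heat_semigroup subrKA scalerBr.
rewrite [X in X - _]addrC -addrA -scalerBl; congr (_ + _).
by rewrite -scaleNr; congr (_ *: _); rewrite -!rmorphB -rmorphN/=; congr (_%:C); ring.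
Qed.

Lemma trunc_norm_conv_term_refine alpha gamma T M W Y :
  path_bounds alpha gamma T M W Y ->
  forall r F t k n, 0 <= r -> 0 <= gamma -> gamma <= 1 -> t <= T ->
  (n < ncells k t)%N ->
  trunc_norm (alpha - gamma - 2^-1 + r) F
    (conv_term W Y t k.+1 n.*2 + conv_term W Y t k.+1 n.*2.+1 -
     conv_term W Y t k n) <=
  2 * M ^+ 2 * (expR T * r `^ r) * (2 ^+ k) `^ (- (2 * gamma)) *
  (t - dyadic k.+1 n.*2.+1) `^ (- r).
Proof.
move=> PB r F t k n r0 g0 g1 tT nt; have M0 := path_bounds_ge0 PB.
have [u0 uv vt tu] := cell_bounds nt.
have e0 := @exp2_gt0 R k; have e1 := @exp2_gt0 R k.+1.
have mu : dyadic k.+1 n.*2.+1 - dyadic k n = (2 ^+ k.+1)^-1 :> R.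
  by rewrite -(dyadic_double k n) dyadicB.
have vm : dyadic k n.+1 - dyadic k.+1 n.*2.+1 = (2 ^+ k.+1)^-1 :> R.
  by rewrite -(dyadic_double k n.+1) doubleS dyadicB.
have i1 : 0 < (2 ^+ k.+1)^-1 :> R by rewrite invr_gt0.
have pS : (2 ^+ k.+1)^-1 `^ gamma <= (2 ^+ k) `^ (- gamma) :> R.
  rewrite -pow_step ge0_ler_powR ?nnegrE ?invr_ge0 ?(ltW e0) ?(ltW e1)//.
  by rewrite lef_pV2 ?posrE// ler_weXn2l ?ler1n.
rewrite conv_term_refine.
apply: le_trans (trunc_normZ _ _ _ _) _; rewrite normc_real.
have dW : `|W (dyadic k n.+1) - W (dyadic k.+1 n.*2.+1)| <=
    M * (2 ^+ k) `^ (- gamma).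
  apply: le_trans (path_bounds_W PB _ _ _ _) _; try lra.
  by rewrite vm gtr0_norm// ler_wpM2l.
have tm : 0 < t - dyadic k.+1 n.*2.+1 by lra.
have dY : trunc_norm (alpha - gamma - 2^-1) F
      (Y (dyadic k.+1 n.*2.+1) - Y (dyadic k n) -
       (heat (dyadic k.+1 n.*2.+1 - dyadic k n) (Y (dyadic k n)) -
        Y (dyadic k n))) <= 2 * M * (2 ^+ k) `^ (- gamma).
  apply: le_trans (trunc_normD _ _ _ _) _; rewrite trunc_normN.
  rewrite mulr_natl mulr2n mulrDl lerD//.
    apply: le_trans (path_bounds_dY PB _ _ _ _ _) _; try lra.
    by rewrite mu gtr0_norm// ler_wpM2l.
  apply: le_trans (trunc_norm_heat_sub _ _ _ g0 g1 _) _; first by lra.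
  rewrite mu mulrC; apply: ler_pM => //; rewrite ?trunc_norm_ge0 ?powR_ge0//.
  have -> : alpha - gamma - 2^-1 + gamma = alpha - 2^-1 by ring.
  by apply: (path_bounds_Y PB); lra.
have tmT : t - dyadic k.+1 n.*2.+1 <= T by lra.
apply: le_trans (ler_pM _ (trunc_norm_ge0 _ _ _) dW
  (heat_smoothing _ F _ r0 tm tmT)) _ => //.
apply: (@le_trans _ _ (M * (2 ^+ k) `^ (- gamma) *
    (expR T * r `^ r * (t - dyadic k.+1 n.*2.+1) `^ (- r) *
     (2 * M * (2 ^+ k) `^ (- gamma))))).
  by rewrite ler_wpM2l ?mulr_ge0 ?powR_ge0// ler_wpM2l// !mulr_ge0 ?expR_ge0 ?powR_ge0.
have -> : - (2 * gamma) = - gamma + - gamma by ring.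
rewrite powRD; last by apply/implyP => _; rewrite gt_eqF.
by rewrite le_eqVlt; apply/orP; left; apply/eqP; ring.
Qed.

(** The first level whose mesh is at most [h]: the length [h] is then at most [T]
    meshes at level 0, and less than 2 meshes otherwise. *)
Lemma exists_level (h T : R) : 0 < h -> h <= T ->
  exists k, (2 ^+ k)^-1 <= h /\ h * 2 ^+ k <= T + 2.
Proof.
move=> h0 hT.
have ex : exists k, 1 <= h * 2 ^+ k.
  exists (Num.truncn h^-1); rewrite mulrC -ler_pdivrMr// mul1r.
  apply: le_trans (ltW (truncnS_gt _)) _.
  by rewrite -natrX ler_nat ltn_expl.
case: (ex_minnP ex) => k hk kmin; exists k; split.
  by rewrite -[leLHS]mul1r ler_pdivrMr ?exp2_gt0.
case: k hk kmin => [_ _|k _ kmin]; first by rewrite expr0; lra.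
have : h * 2 ^+ k < 1 by rewrite ltNge; apply/negP => /kmin; rewrite ltnn.
by rewrite exprS; lra.
Qed.

End pathwise_estimates.

(** * Bounds on the convolution sums between two times *)

Section convolution_bound.
Context {R : realType}.
Implicit Types (alpha gamma T M e r s t : R) (F : {fset int * int}).
Implicit Types (W : R -> R) (Y : R -> torus_distr R) (k m n : nat).

(** [(2 `^ (- e)) ^+ k] is the mesh of level [k] to the power [e]. *)
Lemma geometric_le_powR e h k : 0 <= e -> (2 ^+ k)^-1 <= h ->
  (2 `^ (- e)) ^+ k <= h `^ e.
Proof.
move=> e0 kh; have i0 : 0 <= (2 ^+ k)^-1 :> R by rewrite invr_ge0 ltW ?exp2_gt0.
rewrite -powR_exp2 -pow_step ge0_ler_powR// nnegrE//.
exact: le_trans i0 kh.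
Qed.

Lemma step_le k0 k h : (k0 <= k)%N -> (2 ^+ k0)^-1 <= h -> (2 ^+ k)^-1 <= h :> R.
Proof.
move=> kk; apply: le_trans.
by rewrite lef_pV2 ?posrE ?exp2_gt0// ler_weXn2l ?ler1n.
Qed.

(** In B_(alpha + e): a single term is smoothed by 1/2 + e = gamma - e, a defect
    of additivity by 2 gamma - e > 1. *)
Lemma dyadic_sum_conv_smooth alpha gamma T M W Y :
  path_bounds alpha gamma T M W Y -> 2^-1 < gamma -> gamma < 1 -> 0 < T ->
  let e := (gamma - 2^-1) / 2 in
  exists2 C : R, 0 <= C & forall s t k0 F k, 0 <= s -> s < t -> t <= T ->
  (2 ^+ k0)^-1 <= t - s -> (t - s) * 2 ^+ k0 <= T + 2 -> (k0 <= k)%N ->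
  let J k := dyadic_sum (conv_term W Y t) k s t in
  (forall m, (k <= m)%N ->
    trunc_norm (alpha + e) F (J m - J k) <= C * (2 `^ (- e)) ^+ k) /\
  trunc_norm (alpha + e) F (J k) <= C * (t - s) `^ e.
Proof.
move=> PB g2 g1 T0 e; have M0 := path_bounds_ge0 PB.
have ge : gamma = 2^-1 + 2 * e by rewrite /e; field.
have e0 : 0 < e by rewrite /e; lra.
move: e ge e0 => e ge e0.
have p1 : 1 < 2 * gamma - e by lra.
set A := 2 * M ^+ 2 * (expR T * (2 * gamma - e) `^ (2 * gamma - e)).
set D := M ^+ 2 * (expR T * (gamma - e) `^ (gamma - e)).
have A0 : 0 <= A by rewrite !mulr_ge0 ?sqr_ge0 ?expR_ge0 ?powR_ge0.
have D0 : 0 <= D by rewrite !mulr_ge0 ?sqr_ge0 ?expR_ge0 ?powR_ge0.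
have K0 := sewing_const_ge0 p1 e0 A0 D0.
set K := sewing_const _ _ _ _ in K0.
have LD0 : 0 <= (T + 2 + 1) * D by rewrite mulr_ge0//; lra.
exists ((T + 2 + 1) * D + K); first by rewrite addr_ge0.
move=> s t k0 F k s0 st tT k0h k0L kk J.
have [cau bd] : (forall k m, (k0 <= k)%N -> (k <= m)%N ->
      trunc_norm (alpha + e) F (J m - J k) <= K * (2 `^ (- e)) ^+ k) /\
    (forall k, (k0 <= k)%N -> trunc_norm (alpha + e) F (J k) <=
      ((T + 2 + 1) * D + K) * (2 `^ (- e)) ^+ k0).
  apply: dyadic_sum_bound => // [|i n _ _ nt|i n _ nt]; first exact: ltW.
    have := trunc_norm_conv_term_refine PB F (_ : 0 <= 2 * gamma - e)
      (_ : 0 <= gamma) (_ : gamma <= 1) tT nt.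
    rewrite (_ : alpha - gamma - 2^-1 + (2 * gamma - e) = alpha + e); last first.
      by rewrite ge; field.
    by rewrite (_ : 2 * gamma - e + e = 2 * gamma) ?subrK//; apply; lra.
  have := trunc_norm_conv_term PB F (_ : 0 <= gamma - e) tT nt.
  rewrite (_ : alpha - 2^-1 + (gamma - e) = alpha + e); last by rewrite ge; ring.
  rewrite (_ : gamma - (gamma - e) = e); last by ring.
  by rewrite powR_exp2; apply; lra.
split=> [m km|].
  apply: le_trans (cau _ _ kk km) _.
  by rewrite ler_wpM2r ?exprn_ge0 ?powR_ge0// lerDr.
apply: le_trans (bd _ kk) _; rewrite ler_wpM2l ?addr_ge0//.
by apply: geometric_le_powR => //; exact: ltW.
Qed.

(** In B_(alpha - gamma) the defect is smoothed by 1/2 only. The midpoint is at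
    distance at most 2 (t - s) from [t], so the singularity of order 1/2 is
    bounded by the summable one of order 2 gamma - e at the price of a
    power gamma + e of that distance, itself written as a constant times
    [(t - s) `^ (gamma - e)]. *)
Lemma trunc_norm_conv_term_refine_rough alpha gamma T M W Y :
  path_bounds alpha gamma T M W Y ->
  forall e F s t k n, 0 < e -> gamma = 2^-1 + 2 * e -> gamma <= 1 ->
  0 <= s -> s < t -> t <= T -> (2 ^+ k)^-1 <= t - s ->
  (ncells k s <= n)%N -> (n < ncells k t)%N ->
  trunc_norm (alpha - gamma) F
    (conv_term W Y t k.+1 n.*2 + conv_term W Y t k.+1 n.*2.+1 -
     conv_term W Y t k n) <=
  2 * M ^+ 2 * (expR T * 2^-1 `^ 2^-1) *
    ((2 * T) `^ (2 * e) * 2 `^ (gamma - e)) * (t - s) `^ (gamma - e) *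
  (2 ^+ k) `^ (- (2 * gamma)) * (t - dyadic k.+1 n.*2.+1) `^ (- (2 * gamma - e)).
Proof.
move=> PB e F s t k n e0 ge g1 s0 st tT kh sn nt; have M0 := path_bounds_ge0 PB.
have := trunc_norm_conv_term_refine PB F (_ : 0 <= 2^-1) (_ : 0 <= gamma) g1 tT nt.
rewrite (_ : alpha - gamma - 2^-1 + 2^-1 = alpha - gamma); last by ring.
have g0 : 0 <= gamma by rewrite ge; lra.
have i0 : 0 <= 2^-1 :> R by [].

move=> /(_ i0 g0) /le_trans; apply.
have [u0 uv vt tu] := cell_bounds nt.
have mid : dyadic k n <= dyadic k.+1 n.*2.+1 :> R.
  by rewrite -dyadic_double dyadic_mono.
have mid' : dyadic k.+1 n.*2.+1 < dyadic k n.+1 :> R.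
  by rewrite -(dyadic_double k n.+1) doubleS ltr_pM2r ?invr_gt0 ?exp2_gt0// ltr_nat.
have x0 : 0 < t - dyadic k.+1 n.*2.+1 by lra.
have xh : t - dyadic k.+1 n.*2.+1 <= 2 * (t - s).
  by have := ncells_gt sn; have := @dyadicB R k n; lra.
move: (t - dyadic k.+1 n.*2.+1) x0 xh => x x0 xh.
have xpow : x `^ (- 2^-1) <= (2 * T) `^ (2 * e) * 2 `^ (gamma - e) *
    (t - s) `^ (gamma - e) * x `^ (- (2 * gamma - e)).
  rewrite [X in x `^ X](_ : - 2^-1 = (2 * e + (gamma - e)) + - (2 * gamma - e));
    last by rewrite ge; field.
  rewrite [leLHS]powRD; last by apply/implyP => _; rewrite gt_eqF.
  rewrite ler_wpM2r ?powR_ge0// [leLHS]powRD; last first.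
    by apply/implyP => _; rewrite gt_eqF.
  have hs : 0 <= t - s by lra.
  rewrite -mulrA -powRM//; apply: ler_pM; rewrite ?powR_ge0//.
    by apply: ge0_ler_powR; rewrite ?nnegrE; lra.
  by apply: ge0_ler_powR; rewrite ?nnegrE; lra.
rewrite [leRHS](_ : _ = 2 * M ^+ 2 * (expR T * 2^-1 `^ 2^-1) *
  (2 ^+ k) `^ (- (2 * gamma)) * ((2 * T) `^ (2 * e) * 2 `^ (gamma - e) *
  (t - s) `^ (gamma - e) * x `^ (- (2 * gamma - e)))); last by ring.
by rewrite ler_wpM2l// !mulr_ge0 ?expR_ge0 ?sqr_ge0 ?powR_ge0.
Qed.

(** The factor [(t - s) `^ (gamma - e)] common to terms and defects, times the
    factor (t - s)^e coming from the starting mesh, gives the power gamma. *)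
Lemma dyadic_sum_conv_rough alpha gamma T M W Y :
  path_bounds alpha gamma T M W Y -> 2^-1 < gamma -> gamma < 1 -> 0 < T ->
  exists2 C : R, 0 <= C & forall s t k0 F k, 0 <= s -> s < t -> t <= T ->
  (2 ^+ k0)^-1 <= t - s -> (t - s) * 2 ^+ k0 <= T + 2 -> (k0 <= k)%N ->
  trunc_norm (alpha - gamma) F (dyadic_sum (conv_term W Y t) k s t) <=
  C * (t - s) `^ gamma.
Proof.
move=> PB g2 g1 T0; have M0 := path_bounds_ge0 PB.
have [e ge] : exists e, gamma = 2^-1 + 2 * e.
  by exists ((gamma - 2^-1) / 2); field.
have e0 : 0 < e by lra.
have p1 : 1 < 2 * gamma - e by lra.
set A := 2 * M ^+ 2 * (expR T * 2^-1 `^ 2^-1) *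
  ((2 * T) `^ (2 * e) * 2 `^ (gamma - e)).
have A0 : 0 <= A by rewrite !mulr_ge0 ?sqr_ge0 ?expR_ge0 ?powR_ge0.
have D0 : 0 <= M ^+ 2 by rewrite sqr_ge0.
have K0 := sewing_const_ge0 p1 e0 A0 D0.
set K := sewing_const _ _ _ _ in K0.
have L0 : 0 <= T + 2 + 1 by lra.
exists ((T + 2 + 1) * M ^+ 2 + K); first by rewrite addr_ge0// mulr_ge0.
move=> s t k0 F k s0 st tT k0h k0L kk.
have h0 : 0 < t - s by lra.
set h' := (t - s) `^ (gamma - e); have h'0 : 0 <= h' by exact: powR_ge0.
have refine i n : (k0 <= i)%N -> (ncells i s <= n)%N -> (n < ncells i t)%N ->
    trunc_norm (alpha - gamma) F (conv_term W Y t i.+1 n.*2 +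
      conv_term W Y t i.+1 n.*2.+1 - conv_term W Y t i n) <=
    A * h' * (2 ^+ i) `^ (- (2 * gamma - e + e)) *
    (t - dyadic i.+1 n.*2.+1) `^ (- (2 * gamma - e)).
  move=> ik sn nt; rewrite subrK.
  exact: (trunc_norm_conv_term_refine_rough PB F e0 ge (ltW g1) s0 st tT
    (step_le ik k0h) sn nt).
have term i n : (k0 <= i)%N -> (n < ncells i t)%N ->
    trunc_norm (alpha - gamma) F (conv_term W Y t i n) <=
    M ^+ 2 * h' * (2 `^ (- e)) ^+ i.
  move=> ik nt.
  apply: le_trans (trunc_norm_conv_term_weak PB F (ltW g2) tT nt) _.
  rewrite -mulrA ler_wpM2l// (_ : - gamma = - (gamma - e) + - e); last by ring.
  rewrite powRD; last by apply/implyP => _; rewrite gt_eqF ?exp2_gt0.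
  rewrite (powR_exp2 i e) ler_wpM2r ?exprn_ge0 ?powR_ge0//.
  rewrite powR_exp2 geometric_le_powR//; first by lra.
  exact: step_le ik k0h.
have [_ bd] := dyadic_sum_bound s0 (ltW st) p1 e0 (mulr_ge0 A0 h'0)
  (mulr_ge0 D0 h'0) k0L refine term.
have sc : sewing_const (2 * gamma - e) e (A * h') (M ^+ 2 * h') = K * h'.
  by rewrite /K /sewing_const; ring.
apply: le_trans (bd _ kk) _; rewrite sc mulrA -mulrDl -mulrA ler_wpM2l//.
  by rewrite addr_ge0// mulr_ge0.
rewrite -[X in _ <= _ `^ X](subrK e) powRD; last first.
  by apply/implyP => _; rewrite gt_eqF.
by rewrite ler_wpM2l// geometric_le_powR// ltW.
Qed.

(** The starting level, whose mesh is comparable to [t - s], depends on [s] and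
    [t]; the constant does not, and neither depends on the truncation. *)
Lemma dyadic_sum_conv_bound alpha gamma T M W Y :
  path_bounds alpha gamma T M W Y -> 2^-1 < gamma -> gamma < 1 -> 0 < T ->
  let e := (gamma - 2^-1) / 2 in
  exists2 C : R, 0 <= C & forall s t, 0 <= s -> s < t -> t <= T ->
  let J k := dyadic_sum (conv_term W Y t) k s t in
  exists k0, forall F k, (k0 <= k)%N ->
  [/\ forall m, (k <= m)%N ->
        trunc_norm (alpha + e) F (J m - J k) <= C * (2 `^ (- e)) ^+ k,
      trunc_norm (alpha + e) F (J k) <= C * (t - s) `^ e &
      trunc_norm (alpha - gamma) F (J k) <= C * (t - s) `^ gamma].
Proof.
move=> PB g2 g1 T0 e.
have [C1 C10 h1] := dyadic_sum_conv_smooth PB g2 g1 T0.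
have [C2 C20 h2] := dyadic_sum_conv_rough PB g2 g1 T0.
exists (C1 + C2); first by rewrite addr_ge0.
move=> s t s0 st tT J.
have [k0 [k0h k0L]] := @exists_level R (t - s) T ltac:(lra) ltac:(lra).
exists k0 => F k kk.
have [cau bd] := h1 _ _ _ F _ s0 st tT k0h k0L kk.
have bd2 := h2 _ _ _ F _ s0 st tT k0h k0L kk.
split=> [m km||].
- apply: le_trans (cau _ km) _.
  by rewrite ler_wpM2r ?exprn_ge0 ?powR_ge0// lerDl.
- by apply: le_trans bd _; rewrite ler_wpM2r ?powR_ge0// lerDl.
- by apply: le_trans bd2 _; rewrite ler_wpM2r ?powR_ge0// lerDr.
Qed.

End convolution_bound.

(** * Limits and completeness in the Sobolev spaces *)

Section sobolev_limits.
Context {R : realType}.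
Implicit Types (b alpha e M : R) (u v : torus_distr R).

(** Convergence to 0 of a nonnegative extended real function. *)
Lemma cvge0P (I : Type) (G : set_system I) {FG : Filter G} (f : I -> \bar R) :
  (forall x, 0 <= f x)%E ->
  (f x @[x --> G] --> (0 : \bar R)) <->
  (forall e : R, 0 < e -> \forall x \near G, (f x < e%:E)%E).
Proof.
move=> f0; split=> [fG e e0|fG A].
  by apply: (fG [set y | y < e%:E]%E); apply: open_ereal_lt'; rewrite lte_fin.
move=> A0; have /nbhs_ballP[e /= e0 eA] : nbhs (0 : R) (fun r => A r%:E) by exact: A0.
have := fG _ e0; apply: filterS => x fxe.
have fx : f x = (fine (f x))%:E.
  by rewrite fineK// ge0_fin_numE//; exact: lt_le_trans fxe (leey _).
have r0 : 0 <= fine (f x) by rewrite fine_ge0.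
suff : A (fine (f x))%:E by rewrite -fx.
apply: eA; rewrite /ball/= sub0r normrN ger0_norm//.
by rewrite -lte_fin -fx.
Qed.

Lemma lty_ex_bound (x : \bar R) : (x < +oo)%E -> exists2 M : R, 0 <= M & (x <= M%:E)%E.
Proof.
case: x => [r _||_]; [|by rewrite ltxx|by exists 0; rewrite ?leNye].
by exists (Num.max 0 r); rewrite ?lee_fin le_max lexx ?orbT.
Qed.

Lemma B_Bnorm b u : B b u -> Bnorm b u = (fine (Bnorm b u))%:E.
Proof. by move=> Bu; rewrite fineK// ge0_fin_numE ?Bnorm_ge0. Qed.

Lemma trunc_norm_le_fine b u (F : {fset int * int}) : B b u ->
  trunc_norm b F u <= fine (Bnorm b u).
Proof.
by move=> Bu; apply: trunc_norm_le; rewrite ?fine_ge0 ?Bnorm_ge0// -B_Bnorm.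
Qed.

Lemma B_le b u M : (forall F : {fset int * int}, trunc_norm b F u <= M) -> B b u.
Proof. by move=> /Bnorm_le uM; apply: le_lt_trans uM (ltry _). Qed.

Lemma fine_Bnorm_le b u v M : B b v -> 0 <= M -> (Bnorm b (u - v)%R <= M%:E)%E ->
  B b u /\ fine (Bnorm b u) <= fine (Bnorm b v) + M.
Proof.
move=> Bv M0 uvM.
have h (F : {fset int * int}) : trunc_norm b F u <= fine (Bnorm b v) + M.
  rewrite -[u](subrK v) addrC; apply: le_trans (trunc_normD _ _ _ _) _.
  by rewrite lerD// ?trunc_norm_le_fine// trunc_norm_le.
have Bu := B_le h; split=> //.
by rewrite -lee_fin -B_Bnorm//; exact: Bnorm_le.
Qed.

Lemma Bnorm_distC b u v : Bnorm b (u - v) = Bnorm b (v - u).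
Proof.
rewrite /Bnorm /sobolev_norm; congr (_ `^ _)%E.
apply: eq_esum => k _; congr (_ * _ ^+ 2)%:E.
rewrite (_ : (u - v) k = - ((v - u) k)); first exact: normcN.
by rewrite -[RHS]/((- (v - u)) k) opprB.
Qed.

Lemma real_cauchy_cvg (x : nat -> R) :
  (forall e, 0 < e -> exists N, forall m n, (N <= m)%N -> (N <= n)%N ->
    `|x m - x n| < e) -> exists l : R, x n @[n --> \oo] --> l.
Proof.
move=> h; suff : cvg (x n @[n --> \oo]) by move=> c; exists (lim (x n @[n --> \oo])).
apply: cauchy_cvg; apply: cauchy_exP => e e0.
have [N hN] := h _ e0; exists (x N); exists N => // n /= Nn.
by rewrite /ball/=; exact: hN.
Qed.

Lemma Re_le_normc (z : R[i]) : `|complex.Re z| <= Normc.normc z.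
Proof.
by case: z => x y /=; rewrite -sqrtr_sqr ler_wsqrtr// lerDl sqr_ge0.
Qed.

Lemma Im_le_normc (z : R[i]) : `|complex.Im z| <= Normc.normc z.
Proof.
by case: z => x y /=; rewrite -sqrtr_sqr ler_wsqrtr// lerDr sqr_ge0.
Qed.

Lemma normc_le_ReIm (z : R[i]) :
  Normc.normc z <= `|complex.Re z| + `|complex.Im z|.
Proof.
case: z => x y /=; rewrite -[leRHS]ger0_norm ?addr_ge0// -sqrtr_sqr ler_wsqrtr//.
by rewrite sqrrD !real_normK ?num_real// lerD2r lerDl mulrn_wge0 ?mulr_ge0.
Qed.

Lemma cvg_trunc_norm b (F : seq (int * int)) (x : nat -> torus_distr R) l :
  (forall k, Normc.normc (x n k - l k) @[n --> \oo] --> 0) ->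
  trunc_norm b F (x n - l) @[n --> \oo] --> 0.
Proof.
move=> h; have : \sum_(k <- F) weight k `^ b * Normc.normc (x n k - l k)
    @[n --> \oo] --> \sum_(k <- F) weight k `^ b * 0.
  apply: cvg_big => [|k _]; first exact: add_continuous.
  by apply: cvgM; [exact: cvg_cst|exact: h].
rewrite big1; last by move=> k _; rewrite mulr0.
apply: squeeze_cvgr; last exact: cvg_cst.
by apply: nearW => n; rewrite trunc_norm_ge0 trunc_norm_sumr.
Qed.

(** The limit is taken coefficient by coefficient; on finitely many frequencies
    this is convergence in norm, so the Cauchy estimate passes to the limit in
    every truncated norm. *)
Lemma B_complete alpha (x : nat -> torus_distr R) :
  cauchy_in_B alpha x -> exists l, cvg_in_B alpha x l.
Proof.
move=> [Bx xC].
have xC' e : 0 < e -> exists N, forall m n, (N <= m)%N -> (N <= n)%N ->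
    forall F : {fset int * int}, trunc_norm alpha F (x m - x n) <= e.
  move=> e0; have [N hN] := xC _ e0; exists N => m n Nm Nn F.
  by apply: trunc_norm_le; [exact: ltW|exact: ltW (hN _ _ Nm Nn)].
have coefC k e : 0 < e -> exists N, forall m n, (N <= m)%N -> (N <= n)%N ->
    Normc.normc (x m k - x n k) < e.
  move=> e0; have w0 := powR_gt0 alpha (@weight_gt0 R k).
  have [|N hN] := xC' (e / 2 * weight k `^ alpha); first by rewrite mulr_gt0 ?divr_gt0.
  exists N => m n Nm Nn; have := hN _ _ Nm Nn [fset k]%fset.
  rewrite trunc_norm_fset1 mulrC ler_pM2r// => /le_lt_trans; apply.
  by rewrite ltr_pdivrMr// ltr_pMr// ltr1n.
have [lRe hRe] : {lRe : int * int -> R & forall k, complex.Re (x n k) @[n --> \oo] --> lRe k}.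
  apply: (@choice _ R (fun k l => complex.Re (x n k) @[n --> \oo] --> l)) => k.
  apply: real_cauchy_cvg => e /coefC-/(_ k)[N hN]; exists N => m n Nm Nn.
  apply: le_lt_trans (hN _ _ Nm Nn); apply: le_trans (Re_le_normc _).
  by case: (x m k) (x n k) => [? ?] [? ?].
have [lIm hIm] : {lIm : int * int -> R & forall k, complex.Im (x n k) @[n --> \oo] --> lIm k}.
  apply: (@choice _ R (fun k l => complex.Im (x n k) @[n --> \oo] --> l)) => k.
  apply: real_cauchy_cvg => e /coefC-/(_ k)[N hN]; exists N => m n Nm Nn.
  apply: le_lt_trans (hN _ _ Nm Nn); apply: le_trans (Im_le_normc _).
  by case: (x m k) (x n k) => [? ?] [? ?].
pose l : torus_distr R := fun k => Complex (lRe k) (lIm k).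
have xl k : Normc.normc (x n k - l k) @[n --> \oo] --> 0.
  have : `|complex.Re (x n k) - lRe k| + `|complex.Im (x n k) - lIm k|
      @[n --> \oo] --> `|lRe k - lRe k| + `|lIm k - lIm k|.
    by apply: cvgD; apply: cvg_norm; apply: cvgB => //; exact: cvg_cst.
  rewrite !subrr normr0 addr0; apply: squeeze_cvgr; last exact: cvg_cst.
  apply: nearW => n; rewrite normc_ge0/=; apply: le_trans (normc_le_ReIm _) _.
  by rewrite /l; case: (x n k).
have xlim e : 0 < e -> exists N, forall n, (N <= n)%N ->
    forall F : {fset int * int}, trunc_norm alpha F (x n - l) <= e.
  move=> e0; have [N hN] := xC' _ e0; exists N => n Nn F.
  apply/ler_addgt0Pr => d d0.
  have /cvgr0Pnorm_lt/(_ _ d0)[M _ hM] := cvg_trunc_norm alpha F xl.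
  have := hM (maxn M N) (leq_maxl _ _).
  rewrite /= ger0_norm ?trunc_norm_ge0// => /ltW hd.
  rewrite -[x n](subrK (x (maxn M N))) -addrA.
  apply: le_trans (trunc_normD _ _ _ _) _; rewrite lerD//.
  by apply: hN => //; exact: leq_maxr.
exists l; split.
  have [N hN] := xlim _ ltr01.
  have [] := @fine_Bnorm_le alpha l (x N) 1 (Bx N) ler01 _; last by [].
  by rewrite Bnorm_distC; apply: Bnorm_le; exact: hN.
apply/cvge0P => [n|e e0]; first exact: Bnorm_ge0.
have [|N hN] := xlim (e / 2); first by rewrite divr_gt0.
exists N => // n /= Nn.
apply: le_lt_trans (Bnorm_le (hN _ Nn)) _.
by rewrite lte_fin ltr_pdivrMr// ltr_pMr// ltr1n.
Qed.

Lemma cvg_in_B_trunc_norm alpha (x : nat -> torus_distr R) l e : 0 < e ->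
  cvg_in_B alpha x l -> exists N, forall n, (N <= n)%N ->
  forall F : {fset int * int}, trunc_norm alpha F (x n - l) <= e.
Proof.
move=> e0 [_ /cvge0P-/(_ (fun n => Bnorm_ge0 _ _) _ e0)[N _ hN]].
exists N => n Nn F; apply: trunc_norm_le; first exact: ltW.
by apply: ltW; exact: hN.
Qed.

(** Bounds in a weaker norm pass to limits taken in B_alpha. *)
Lemma cvg_in_B_dist_le alpha b (x y : nat -> torus_distr R) l l' M k0
    (F : {fset int * int}) : b <= alpha ->
  cvg_in_B alpha x l -> cvg_in_B alpha y l' ->
  (forall k, (k0 <= k)%N -> trunc_norm b F (x k - y k) <= M) ->
  trunc_norm b F (l - l') <= M.
Proof.
move=> ba xl yl h; apply/ler_addgt0Pr => e e0.
have e20 : 0 < e / 2 by rewrite divr_gt0.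
have [N1 h1] := cvg_in_B_trunc_norm e20 xl.
have [N2 h2] := cvg_in_B_trunc_norm e20 yl.
pose n := (k0 + N1 + N2)%N.
have -> : l - l' = (x n - y n) + ((l - x n) + (y n - l')).
  by rewrite [l - x n]addrC addrA addrA addrAC; ring.
apply: le_trans (trunc_normD _ _ _ _) _; rewrite lerD//.
  by apply: h; rewrite /n; lia.
apply: le_trans (trunc_normD _ _ _ _) _; rewrite [e]splitr lerD//.
  rewrite trunc_norm_distC; apply: le_trans (le_trunc_norm _ _ ba) _.
  by apply: h1; rewrite /n; lia.
by apply: le_trans (le_trunc_norm _ _ ba) _; apply: h2; rewrite /n; lia.
Qed.

End sobolev_limits.

(** * The pathwise theorem *)

Section pathwise_theorem.
Context {R : realType}.
Implicit Types (alpha gamma T M e r s t : R).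
Implicit Types (W : R -> R) (Y : R -> torus_distr R) (k m n : nat).

(** The cells contained in [[0, t]] are the first [ncells k t] ones. *)
Lemma convolution_sumE Y W k t : 0 <= t ->
  convolution_sum Y W k t = dyadic_sum (conv_term W Y t) k 0 t.
Proof.
move=> t0; rewrite /convolution_sum /dyadic_sum ncells0 big_mkord fsbig_ord.
congr (\big[_/_]_(_ \in _) _); apply/seteqP; split=> n /=.
  rewrite ncellsP => sub.
  have := sub (dyadic k n.+1).
  by rewrite /= !in_itv/= lexx dyadic_mono// => /(_ isT)/andP[].
rewrite ncellsP => nt x /=; rewrite !in_itv/= => /andP[ux xv].
by rewrite (le_trans (dyadic_ge0 _ _) ux) (le_trans xv nt).
Qed.

(** By the semigroup property the cells contained in [[0, s]] contribute to the
    sum at time [t] the image by the semigroup of the sum at time [s]. *)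
Lemma convolution_sum_split Y W k s t : 0 <= s -> s <= t ->
  convolution_sum Y W k t - convolution_sum Y W k s =
  (heat (t - s) (convolution_sum Y W k s) - convolution_sum Y W k s) +
  dyadic_sum (conv_term W Y t) k s t.
Proof.
move=> s0 st; have t0 : 0 <= t by exact: le_trans st.
rewrite !convolution_sumE// /dyadic_sum ncells0.
rewrite (big_cat_nat (n := ncells k s))//= ?ncells_le// heat_sum.
rewrite [RHS]addrAC; congr (_ + _ - _); apply: eq_bigr => n _.
rewrite /conv_term heatZ -heat_semigroup; congr (_ *: heat _ _); ring.
Qed.

Lemma holder_path_bound (V : zmodType) (N : V -> \bar R) T gamma (y : R -> V) :
  holder_path N T gamma y -> exists2 M, 0 <= M & forall s t,
  0 <= s -> s <= T -> 0 <= t -> t <= T -> s != t ->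
  (N (y t - y s)%R <= (M * `|t - s| `^ gamma)%:E)%E.
Proof.
move=> [_ /lty_ex_bound[M M0 hM]]; exists M => // s t s0 sT t0 tT st.
have d0 : 0 < `|t - s| `^ gamma.
  by rewrite powR_gt0// normr_gt0 subr_eq0 eq_sym.
rewrite EFinM -lee_pdivrMr//; apply: le_trans hM; apply: ereal_sup_ubound.
by exists s, t; rewrite !in_itv/= s0 sT t0 tT.
Qed.

(** The norm of a continuous path is a continuous function on a segment. *)
Lemma continuous_path_bound b T Y : 0 <= T ->
  continuous_path (Bnorm b) T Y ->
  exists2 M, 0 <= M & forall t, 0 <= t -> t <= T -> (Bnorm b (Y t) <= M%:E)%E.
Proof.
move=> T0 cY.
have BY t : t \in `[0, T] -> B b (Y t) by move=> /cY[].
have fc : {within `[0, T], continuous (fun t => fine (Bnorm b (Y t)))}.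
  apply/subspace_continuousP => t tT; apply/cvgrPdist_le => e e0.
  have [Bt /cvge0P-/(_ (fun _ => Bnorm_ge0 _ _) _ e0)] := cY t tT.
  rewrite !near_withinE; apply: filterS => s + sT => /(_ sT) /ltW h.
  have [_ h1] := fine_Bnorm_le Bt (ltW e0) h.
  rewrite Bnorm_distC in h; have [_ h2] := fine_Bnorm_le (BY _ sT) (ltW e0) h.
  by rewrite /from_subspace ler_norml; apply/andP; split; lra.
have [c cT hc] := EVT_max T0 fc.
exists (fine (Bnorm b (Y c))); first by rewrite fine_ge0 ?Bnorm_ge0.
move=> t t0 tT; have tI : t \in `[0, T] by rewrite in_itv/= t0 tT.
by rewrite (B_Bnorm (BY _ tI)) lee_fin; exact: hc.
Qed.

Lemma exists_path_bounds alpha gamma T W Y : 0 < gamma -> 0 <= T ->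
  holder_path (fun x : R => `|x|%:E) T gamma W ->
  continuous_path (Bnorm (alpha - 2^-1)) T Y ->
  holder_path (Bnorm (alpha - gamma - 2^-1)) T gamma Y ->
  exists M, path_bounds alpha gamma T M W Y.
Proof.
move=> g0 T0 /holder_path_bound[M1 M10 h1] /(continuous_path_bound T0)[M2 M20 h2].
move=> /holder_path_bound[M3 M30 h3]; exists (M1 + M2 + M3).
split=> [|s t s0 sT t0 tT|F t t0 tT|F s t s0 sT t0 tT].
- by rewrite !addr_ge0.
- have [<-|st] := eqVneq s t.
    by rewrite subrr normr0 mulr_ge0 ?powR_ge0// !addr_ge0.
  have := h1 _ _ s0 sT t0 tT st; rewrite lee_fin => /le_trans; apply.
  by rewrite ler_wpM2r ?powR_ge0//; lra.
- by apply: (@le_trans _ _ M2); [exact: trunc_norm_le (h2 _ _ _)|lra].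
- have [<-|st] := eqVneq s t.
    by rewrite subrr trunc_norm0 mulr_ge0 ?powR_ge0// !addr_ge0.
  apply: (@le_trans _ _ (M3 * `|t - s| `^ gamma)).
    by apply: trunc_norm_le; [rewrite mulr_ge0 ?powR_ge0|exact: h3].
  by rewrite ler_wpM2r ?powR_ge0//; lra.
Qed.

Lemma B_convolution_sum alpha gamma T M W Y k t :
  path_bounds alpha gamma T M W Y -> 0 <= t -> t <= T ->
  B alpha (convolution_sum Y W k t).
Proof.
move=> PB t0 tT; rewrite convolution_sumE// /dyadic_sum.
apply: (@B_le _ _ _ (\sum_(ncells k 0 <= n < ncells k t)
  (M ^+ 2 * (expR T * 2^-1 `^ 2^-1) * (2 ^+ k) `^ (- (gamma - 2^-1))))) => F.
apply: le_trans (trunc_norm_sum _ _ _ _ _) _; rewrite !big_nat.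
apply: ler_sum => n /andP[_ nt].
have := trunc_norm_conv_term PB F (_ : 0 <= 2^-1) tT nt.
by rewrite subrK; apply; lra.
Qed.

(** The two increments are bounded for all levels from some [k0] on, with a
    constant independent of [s], [t] and the truncation. *)
Lemma convolution_sum_limit alpha gamma T M W Y :
  path_bounds alpha gamma T M W Y -> 2^-1 < gamma -> gamma < 1 -> 0 < T ->
  let e := (gamma - 2^-1) / 2 in
  (forall t, 0 <= t -> t <= T ->
    cauchy_in_B alpha (fun k => convolution_sum Y W k t)) /\
  exists2 C : R, 0 <= C & forall s t, 0 <= s -> s < t -> t <= T ->
    forall F : {fset int * int}, exists k0, forall k, (k0 <= k)%N ->
    trunc_norm alpha F (convolution_sum Y W k t - convolution_sum Y W k s) <=
      C * (t - s) `^ e /\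
    trunc_norm (alpha - gamma) F
      (convolution_sum Y W k t - convolution_sum Y W k s) <=
      C * (t - s) `^ gamma.
Proof.
move=> PB g2 g1 T0 e; have [C C0 hC] := dyadic_sum_conv_bound PB g2 g1 T0.
have e0 : 0 < e by rewrite /e; lra.
have e1 : e <= 1 by rewrite /e; lra.
have ae : alpha <= alpha + e by lra.
have I0 k : convolution_sum Y W k 0 = 0.
  by rewrite convolution_sumE// /dyadic_sum ncells0 big_geq.
have rho0 : 0 <= 2 `^ (- e) :> R by exact: powR_ge0.
have rho1 : `|2 `^ (- e)| < 1 :> R.
  by rewrite ger0_norm// powR2N_lt1.
split=> [t t0 tT|].
  split=> [k|d d0]; first exact: B_convolution_sum PB t0 tT.
  move: t0; rewrite le_eqVlt => /predU1P[<-|t0].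
    exists 0%N => m n _ _; rewrite !I0 subrr.
    apply: (@le_lt_trans _ _ 0%:E); last by rewrite lte_fin.
    by apply: Bnorm_le => F; rewrite trunc_norm0.
  have [k0 hk0] := hC _ _ (lexx 0) t0 tT.
  have : C * (2 `^ (- e)) ^+ k @[k --> \oo] --> C * 0.
    by apply: cvgM; [exact: cvg_cst|exact: cvg_expr].
  rewrite mulr0 => /cvgr0Pnorm_lt/(_ (d / 2))[|k1 _ hk1]; first by rewrite divr_gt0.
  (* The bound in B_(alpha + e) is stronger than the one needed in B_alpha. *)
  have key m n : (k0 + k1 <= n)%N -> (n <= m)%N ->
      (Bnorm alpha (convolution_sum Y W m t - convolution_sum Y W n t)%R < d%:E)%E.
    move=> kn nm; apply: (@le_lt_trans _ _ (d / 2)%:E); last first.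
      by rewrite lte_fin ltr_pdivrMr// ltr_pMr// ltr1n.
    apply: Bnorm_le => F; rewrite !convolution_sumE ?(ltW t0)//.
    have [|h _ _] := hk0 F n; first exact: leq_trans (leq_addr _ _) kn.
    apply: le_trans (le_trunc_norm _ _ ae) _; apply: le_trans (h _ nm) _.
    by apply: le_trans (ler_norm _) _; exact/ltW/hk1/(leq_trans (leq_addl _ _) kn).
  exists (k0 + k1)%N => m n Nm Nn; have [mn|nm] := leqP n m.
    exact: key.
  by rewrite Bnorm_distC; apply: key => //; exact: ltnW.
exists (C * (T `^ e + 1)); first by rewrite mulr_ge0// addr_ge0 ?powR_ge0.
move=> s t s0 st tT F.
have hs0 : 0 <= t - s by lra.
have t0 : 0 <= t by lra.
(* The case [s = 0] is separate: the sums at time 0 are empty. *)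
have [k1 hk1] : exists k1, forall k, (k1 <= k)%N ->
    trunc_norm (alpha + e) F (convolution_sum Y W k s) <= C * T `^ e.
  move: (s0); rewrite le_eqVlt => /predU1P[<-|s0'].
    by exists 0%N => k _; rewrite I0 trunc_norm0 mulr_ge0 ?powR_ge0.
  have [k1 hk1] := hC _ _ (lexx 0) s0' (ltW (lt_le_trans st tT)).
  exists k1 => k kk; rewrite convolution_sumE//.
  have [_ h _] := hk1 F k kk; apply: le_trans h _.
  rewrite subr0 ler_wpM2l// ge0_ler_powR ?nnegrE ?(ltW e0) ?(ltW T0)//.
  by lra.
have [k2 hk2] := hC _ _ s0 st tT.
exists (k1 + k2)%N => k kk.
have [|_ hA hB] := hk2 F k; first exact: leq_trans (leq_addl _ _) kk.
have hs := hk1 k (leq_trans (leq_addr _ _) kk).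
rewrite (convolution_sum_split _ _ _ s0 (ltW st)) mulrDr mulr1 !mulrDl; split.
  apply: le_trans (trunc_normD _ _ _ _) _; rewrite lerD//.
    apply: le_trans (trunc_norm_heat_sub _ _ _ (ltW e0) e1 hs0) _.
    by rewrite mulrC ler_wpM2r ?powR_ge0.
  exact: le_trans (le_trunc_norm _ _ ae) hA.
apply: le_trans (trunc_normD _ _ _ _) _; rewrite lerD//.
apply: le_trans (trunc_norm_heat_sub _ _ _ _ (ltW g1) hs0) _; first by lra.
rewrite subrK mulrC ler_wpM2r ?powR_ge0//.
exact: le_trans (le_trunc_norm _ _ ae) hs.
Qed.

Lemma convolution_int_regular alpha gamma T M W Y :
  path_bounds alpha gamma T M W Y -> 2^-1 < gamma -> gamma < 1 -> 0 < T ->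
  let I := convolution_int alpha Y W in
  [/\ forall t : R, t \in `[0, T] ->
        cauchy_in_B alpha (fun k => convolution_sum Y W k t),
      forall t : R, t \in `[0, T] ->
        cvg_in_B alpha (fun k => convolution_sum Y W k t) (I t),
      continuous_path (Bnorm alpha) T I &
      holder_path (Bnorm (alpha - gamma)) T gamma I].
Proof.
move=> PB g2 g1 T0 I; pose e := (gamma - 2^-1) / 2.
have e0 : 0 < e by rewrite /e; lra.
have [cau [C C0 hC]] := convolution_sum_limit PB g2 g1 T0.
have cauT t : t \in `[0, T] -> cauchy_in_B alpha (fun k => convolution_sum Y W k t).
  by rewrite in_itv/= => /andP[t0 tT]; exact: cau.
have cvgT t : t \in `[0, T] ->
    cvg_in_B alpha (fun k => convolution_sum Y W k t) (I t).
  move=> /cauT/B_complete[l hl].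
  exact: (@xgetPex _ 0 [set l | cvg_in_B alpha _ l] (ex_intro _ l hl)).
have ag : alpha - gamma <= alpha by lra.
have lt_case s t : s \in `[0, T] -> t \in `[0, T] -> s < t ->
    (Bnorm alpha (I t - I s)%R <= (C * `|t - s| `^ e)%:E)%E /\
    (Bnorm (alpha - gamma) (I t - I s)%R <= (C * `|t - s| `^ gamma)%:E)%E.
  move=> sI tI st; rewrite gtr0_norm ?subr_gt0//.
  have /andP[s0 _] : 0 <= s <= T by rewrite in_itv in sI.
  have /andP[_ tT] : 0 <= t <= T by rewrite in_itv in tI.
  split; apply: Bnorm_le => F; have [k0 hk0] := hC _ _ s0 st tT F.
    by apply: (cvg_in_B_dist_le (lexx alpha) (cvgT _ tI) (cvgT _ sI)) => k /hk0[].
  by apply: (cvg_in_B_dist_le ag (cvgT _ tI) (cvgT _ sI)) => k /hk0[].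
have neq_case s t : s \in `[0, T] -> t \in `[0, T] -> s != t ->
    (Bnorm alpha (I t - I s)%R <= (C * `|t - s| `^ e)%:E)%E /\
    (Bnorm (alpha - gamma) (I t - I s)%R <= (C * `|t - s| `^ gamma)%:E)%E.
  move=> sI tI; rewrite neq_lt => /orP[st|ts]; first exact: lt_case.
  rewrite (distrC t s) (Bnorm_distC alpha (I t)) (Bnorm_distC _ (I t)).
  exact: lt_case.
split=> //.
- move=> t tI; split; first by have [] := cvgT _ tI.
  apply/cvge0P => [s|d d0]; first exact: Bnorm_ge0.
  (* The radius solves (C + 1) r^e = d; adding 1 avoids dividing by 0. *)
  pose x := d / (C + 1).
  have C1 : 0 < C + 1 by lra.
  have x0 : 0 < x `^ e^-1 by rewrite powR_gt0// divr_gt0.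
  rewrite near_withinE; exists (x `^ e^-1) => //= s ts sI.
  have [->|ts'] := eqVneq t s.
    apply: (@le_lt_trans _ _ 0%:E); last by rewrite lte_fin.
    by apply: Bnorm_le => F; rewrite subrr trunc_norm0.
  have [/le_lt_trans h _] := neq_case _ _ tI sI ts'; apply: h; rewrite lte_fin.
  rewrite distrC; apply: (@le_lt_trans _ _ ((C + 1) * `|t - s| `^ e)).
    by rewrite ler_wpM2r ?powR_ge0// lerDl.
  rewrite mulrC -ltr_pdivlMr// -/x.
  have -> : x = (x `^ e^-1) `^ e.
    by rewrite -powRrM mulVf ?gt_eqF// powRr1// ltW// divr_gt0.
  by apply: gt0_ltr_powR => //; rewrite nnegrE// ltW.
- split=> [t tI|].
    have [Bt _] := cvgT _ tI; apply: (@B_le _ _ _ (fine (Bnorm alpha (I t)))) => F.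
    by apply: le_trans (le_trunc_norm _ _ ag) _; exact: trunc_norm_le_fine.
  apply: (@le_lt_trans _ _ C%:E); last exact: ltry.
  apply: ge_ereal_sup => _ [s [t [sI tI st ->]]].
  have d0 : 0 < `|t - s| `^ gamma.
    by rewrite powR_gt0// normr_gt0 subr_eq0 eq_sym.
  by rewrite lee_pdivrMr// -EFinM; have [] := neq_case _ _ sI tI st.
Qed.

End pathwise_theorem.

Theorem theorem9 (R : realType) (d : measure_display) (Omega : measurableType d)
    (P : probability Omega R) (H gamma alpha T : R)
    (W : R -> {RV P >-> R}) (Y : R -> Omega -> torus_distr R) :
  2^-1 < H -> H < 1 -> 2^-1 < gamma -> gamma < H -> 0 < T ->
  fBm H T W ->
  (\forall w \ae P,
     continuous_path (Bnorm (alpha - 2^-1)) T (fun t => Y t w) /\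
     holder_path (Bnorm (alpha - gamma - 2^-1)) T gamma (fun t => Y t w)) ->
  \forall w \ae P,
    let Yw := fun t => Y t w in
    let Ww := fun t => W t w in
    let I := convolution_int alpha Yw Ww in
    [/\ forall t : R, t \in `[0, T] ->
          cauchy_in_B alpha (fun k => convolution_sum Yw Ww k t),
        forall t : R, t \in `[0, T] ->
          cvg_in_B alpha (fun k => convolution_sum Yw Ww k t) (I t),
        continuous_path (Bnorm alpha) T I &
        holder_path (Bnorm (alpha - gamma)) T gamma I].
Proof.
move=> H2 H1 g2 gH T0 WfBm; have g0 : 0 < gamma by lra.
have g1 : gamma < 1 by lra.
apply: (filterS2 _ _ (fBm_holder WfBm g0 gH)) => w hW [cY hY].
have [M PB] := exists_path_bounds g0 (ltW T0) hW cY hY.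
exact: convolution_int_regular PB g2 g1 T0.
Qed.
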